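(* Let $n \geq 3$, $s > 3n$ and let $p$ be an odd prime. Let $$X_{n,p}^{(s)} = \mathcal{CC}\big(\mathrm{SL}_{n+1}(\mathbb{F}_p[t]/\langle t^s\rangle), \{K_i\}_{0\le i\le n}\big).$$ Then for every group $\Lambda$ that does not have non-trivial elements of order $p$, $H^1(X_{n,p}^{(s)},\Lambda)=0$.
   Context: **Coset complexes.** For a group $\Gamma$ with subgroups $K_0,\dots,K_n$, the coset complex $\mathcal{CC}(\Gamma, \{K_i\}_{0\le i\le n})$ is the partite simplicial complex with vertices the cosets $gK_i$ ($g\in\Gamma$, $0\le i\le n$; cosets with different indices $i$ are regarded as different vertices), where $\{g_{i_0}K_{i_0},\dots,g_{i_k}K_{i_k}\}$ is a $k$-simplex ($0\le k\le n$) if and only if $0\le i_0<\dots<i_k\le n$ and $g_{i_j}K_{i_j}\cap g_{i_l}K_{i_l}\neq\emptyset$ for all $0\le j,l\le k$. **The subgroups $K_i$.** For a commutative unital ring $R$, $r\in R$ and $1\le i\ne j\le n+1$, $e_{i,j}(r)$ is the $(n+1)\times(n+1)$ matrix with $1$'s on the diagonal, $r$ in entry $(i,j)$ and $0$ elsewhere. Let $\gamma_0$ be the cyclic permutation $(1\,2\,\dots\,n+1)$ of $\{1,\dots,n+1\}$ (so $1\mapsto 2\mapsto\cdots\mapsto n+1\mapsto 1$). For $0\le i\le n$ let $K_i<\mathrm{SL}_{n+1}(\mathbb{F}_p[t])$ be the subgroup generated by all $e_{\gamma_0^i(j),\gamma_0^i(j+1)}(r)$ with $1\le j\le n$, $r\in\mathbb{F}_p[t]$,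 $\deg r\le 3$. For $s>3n$ reduction modulo $t^s$ is injective on each $K_i$, and $K_i$ is identified with its image in $\mathrm{SL}_{n+1}(\mathbb{F}_p[t]/\langle t^s\rangle)$. **Cohomology with coefficients in a (possibly non-abelian) group $\Lambda$.** For a simplicial complex $X$, $X(k)$ is the set of $k$-simplices and $X_{\mathrm{ord}}(k)$ the set of ordered $k$-simplices. $C^0(X,\Lambda)=\{\psi:X(0)\to\Lambda\}$; $C^1(X,\Lambda)=\{\phi:X_{\mathrm{ord}}(1)\to\Lambda:\phi((u,v))=\phi((v,u))^{-1}\}$. $Z^1(X,\Lambda)$ is the set of $\phi\in C^1(X,\Lambda)$ with $\phi((u,v))\phi((v,w))\phi((w,u))=e_\Lambda$ for all $(u,v,w)\in X_{\mathrm{ord}}(2)$. $B^1(X,\Lambda)$ is the set of $\phi\in C^1(X,\Lambda)$ of the form $\phi((u,v))=\psi(u)\psi(v)^{-1}$ for some $\psi\in C^0(X,\Lambda)$. $H^1(X,\Lambda)$ is the set of orbits of $Z^1(X,\Lambda)$ under the action of $C^0(X,\Lambda)$ given by $(\psi.\phi)((u,v))=\psi(u)\phi((u,v))\psi(v)^{-1}$. ''$H^1(X,\Lambda)=0$'' means $H^1(X,\Lambda)$ consists only of the orbit of the constant cocycle $e_\Lambda$; equivalently $Z^1(X,\Lambda)=B^1(X,\Lambda)$. *)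

(* Defs.v *)
From HB Require Import structures.
From mathcomp Require Import all_boot all_order all_algebra all_fingroup.
From mathcomp Require Import boolp classical_sets functions cardinality.

Set Implicit Arguments.
Unset Strict Implicit.
Unset Printing Implicit Defensive.

Import GRing.Theory.

Local Open Scope classical_set_scope.
Local Open Scope ring_scope.

Section SpecialLinear.
Variables (R : comNzRingType) (m : nat).

Record SL : predArgType := MkSL { SL_mx :> 'M[R]_m; _ : \det SL_mx == 1 }.

HB.instance Definition _ := [isSub for SL_mx].
HB.instance Definition _ := [Choice of SL by <:].

Implicit Types A B C : SL.

Lemma det_SL A : \det A = 1.
Proof. by case: A => A /= /eqP. Qed.

Fact SL_one_subproof : \det (1%:M : 'M[R]_m) == 1.
Proof. by rewrite det1. Qed.

Fact SL_mul_subproof A B : \det (A *m B) == 1.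
Proof. by rewrite det_mulmx !det_SL mulr1. Qed.

Fact SL_inv_subproof A : \det (\adj A) == 1.
Proof.
have /(congr1 determinant) := mul_adj_mx A.
by rewrite det_mulmx det_SL mulr1 det1 => ->.
Qed.

Definition SL_one := MkSL SL_one_subproof.
Definition SL_mul A B := MkSL (SL_mul_subproof A B).
Definition SL_inv A := MkSL (SL_inv_subproof A).

Fact SL_mulA : associative SL_mul.
Proof. by move=> A B C; apply: val_inj; rewrite /= mulmxA. Qed.
Fact SL_mul1 : left_id SL_one SL_mul.
Proof. by move=> A; apply: val_inj; rewrite /= mul1mx. Qed.
Fact SL_mulr1 : right_id SL_one SL_mul.
Proof. by move=> A; apply: val_inj; rewrite /= mulmx1. Qed.
Fact SL_mulV : left_inverse SL_one SL_inv SL_mul.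
Proof. by move=> A; apply: val_inj; rewrite /= mul_adj_mx det_SL. Qed.
Fact SL_mulrV : right_inverse SL_one SL_inv SL_mul.
Proof. by move=> A; apply: val_inj; rewrite /= mul_mx_adj det_SL. Qed.

HB.instance Definition _ :=
  isGroup.Build SL SL_mulA SL_mul1 SL_mulr1 SL_mulV SL_mulrV.

End SpecialLinear.

Section SLMap.
Variables (R S : comNzRingType) (f : {rmorphism R -> S}) (m : nat).

Fact SL_map_subproof (A : SL R m) : \det (map_mx f A) == 1.
Proof. by rewrite det_map_mx det_SL rmorph1. Qed.

Definition SL_map (A : SL R m) : SL S m := MkSL (SL_map_subproof A).

Fact SL_mapM : {morph SL_map : A B / (A * B)%g}.
Proof. by move=> A B; apply: val_inj; rewrite /= map_mxM. Qed.

Fact SL_mapF : {morph SL_map : A B / (A * B^-1)%g}.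
Proof.
by move=> A B; apply: val_inj; rewrite /= map_mxM map_mx_adj.
Qed.

HB.instance Definition _ :=
  isGroupMorphism.Build (SL R m) (SL S m) SL_map SL_mapF.

End SLMap.

Record subgroup (G : groupType) := Subgroup {
  subgroup_set :> set G;
  subgroup_closed : group_closed (mem subgroup_set)
}.

Section Subgroups.
Variable G : groupType.

Fact generated_subproof (S : set G) :
  group_closed (mem (smallest (fun H : set G => group_closed (mem H)) S)).
Proof.
split=> [|x y]; first by rewrite inE => H [[H1 _] _]; rewrite inE in H1.
rewrite !inE => Hx Hy H HS; have [_ Hd] := HS.1.
by rewrite -in_setE; apply: Hd; rewrite inE; [apply: Hx|apply: Hy].
Qed.

Definition generated (S : set G) : subgroup G := Subgroup (generated_subproof S).

Variables (G' : groupType) (f : UMagmaMorphism.type G G').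

Fact image_subproof (H : subgroup G) : group_closed (mem (f @` H)).
Proof.
have [H1 Hd] := subgroup_closed H; split=> [|x y].
  by rewrite inE; exists 1%g; rewrite ?gmulf1 // -in_setE.
rewrite !inE => -[a Ha <-] [b Hb <-]; exists (a * b^-1)%g; last exact: gmulfF.
by rewrite -in_setE; apply: Hd; rewrite inE.
Qed.

Definition image_subgroup (H : subgroup G) : subgroup G' :=
  Subgroup (image_subproof H).

Definition left_coset (H : subgroup G) (g : G) : set G :=
  [set (g * h)%g | h in H].

Definition has_order (x : G) (d : nat) : Prop :=
  [/\ (0 < d)%N, (x ^+ d)%g = 1%g &
      forall e, (0 < e < d)%N -> (x ^+ e)%g <> 1%g].

End Subgroups.

(* All singletons are simplices, so [vertex X] is the set X(0). *)
Record simplicial_complex := SimplicialComplex {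
  vertex : Type;
  simplex : set (set vertex);
  simplex_finite : forall A, simplex A -> finite_set A;
  simplex_nonempty : forall A, simplex A -> A !=set0;
  simplex_vertex : forall v, simplex [set v];
  simplex_face : forall A B, A `<=` B -> A !=set0 -> simplex B -> simplex A
}.

Section CosetComplex.
Variables (G : groupType) (m : nat) (K : 'I_m -> subgroup G).

(* The index is part of the vertex, so that equal cosets with different
   indices are different vertices. *)
Definition coset_vertex : set ('I_m * set G) :=
  [set v | exists g, v.2 = left_coset (K v.1) g].

(* Vertices of a simplex have pairwise distinct indices; this makes A finite
   and lets it be written with increasing indices. *)
Definition coset_simplex (A : set coset_vertex) : Prop :=
  A !=set0 /\ forall u v, A u -> A v ->
    ((val u).1 = (val v).1 -> u = v) /\ (val u).2 `&` (val v).2 !=set0.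

Fact coset_simplex_finite A : coset_simplex A -> finite_set A.
Proof.
move=> [_ HA].
have inj : {in A &, injective (fun v : coset_vertex => (val v).1)}.
  by move=> u v /set_mem Au /set_mem Av; case: (HA u v Au Av).
have := @finite_finset _ ((fun v : coset_vertex => (val v).1) @` A).
by rewrite (eq_finite_set (inj_card_eq inj)).
Qed.

Fact coset_simplex_vertex v : coset_simplex [set v].
Proof.
split=> [|_ _ -> ->]; first by exists v.
split=> //; rewrite setIid; case: v => v /= /set_mem [g ->].
exists (g * 1)%g, 1%g => //.
by have [K1 _] := subgroup_closed (K v.1); rewrite inE in K1.
Qed.

Fact coset_simplex_face (A B : set coset_vertex) :
  A `<=` B -> A !=set0 -> coset_simplex B -> coset_simplex A.
Proof. by move=> AB A0 [_ HB]; split=> // u v /AB Bu /AB; apply: HB. Qed.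

Definition coset_complex : simplicial_complex :=
  SimplicialComplex coset_simplex_finite (fun A (h : coset_simplex A) => h.1)
    coset_simplex_vertex coset_simplex_face.

End CosetComplex.

Section Cohomology.
Variables (X : simplicial_complex) (L : groupType).
Local Notation V := (vertex X).

Definition oedge : set (V * V) :=
  [set e : V * V | e.1 <> e.2 /\ simplex [set e.1; e.2]].

Definition otriangle : set (V * V * V) :=
  [set t : V * V * V | [/\ t.1.1 <> t.1.2, t.1.2 <> t.2, t.2 <> t.1.1 &
               simplex [set t.1.1; t.1.2; t.2]]].

Fact oedge_rev_subproof (e : oedge) :
  ((val e).2, (val e).1) \in oedge.
Proof.
by case: e => [[u v] /= /set_mem [/= uv Xuv]]; rewrite inE; split=> /=;
  [exact/nesym | rewrite setUC].
Qed.

Fact oedge01_subproof (t : otriangle) :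
  ((val t).1.1, (val t).1.2) \in oedge.
Proof.
case: t => [[[u v] w] /= /set_mem [/= uv _ _ Xt]]; rewrite inE; split=> //=.
by apply: simplex_face Xt; [move=> x; left | exists u; left].
Qed.

Fact oedge12_subproof (t : otriangle) :
  ((val t).1.2, (val t).2) \in oedge.
Proof.
case: t => [[[u v] w] /= /set_mem [/= _ vw _ Xt]]; rewrite inE; split=> //=.
apply: simplex_face Xt; last by exists v; left.
by move=> x [->|->]; [left; right | right].
Qed.

Fact oedge20_subproof (t : otriangle) :
  ((val t).2, (val t).1.1) \in oedge.
Proof.
case: t => [[[u v] w] /= /set_mem [/= _ _ wu Xt]]; rewrite inE; split=> //=.
apply: simplex_face Xt; last by exists w; left.
by move=> x [->|->]; [right | left; left].
Qed.

Definition oedge_rev (e : oedge) : oedge := SigSub (oedge_rev_subproof e).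
Definition oedge01 (t : otriangle) : oedge := SigSub (oedge01_subproof t).
Definition oedge12 (t : otriangle) : oedge := SigSub (oedge12_subproof t).
Definition oedge20 (t : otriangle) : oedge := SigSub (oedge20_subproof t).

Definition C0 : set (V -> L) := setT.

Definition C1 : set (oedge -> L) :=
  [set phi | forall e, phi e = (phi (oedge_rev e))^-1%g].

Definition Z1 : set (oedge -> L) :=
  [set phi | C1 phi /\ forall t : otriangle,
     (phi (oedge01 t) * phi (oedge12 t) * phi (oedge20 t) = 1)%g].

Definition cochain_act (psi : V -> L) (phi : oedge -> L) : oedge -> L :=
  fun e => (psi (val e).1 * phi e * (psi (val e).2)^-1)%g.

Definition cochain_orbit (phi : oedge -> L) : set (oedge -> L) :=
  [set cochain_act psi phi | psi in C0].

Definition H1 : set (set (oedge -> L)) := [set cochain_orbit phi | phi in Z1].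

Definition H1_trivial : Prop := H1 = [set cochain_orbit (fun=> 1%g)].

End Cohomology.

Definition elem_mx (R : comNzRingType) m (i j : 'I_m) (r : R) : 'M[R]_m :=
  1%:M + r *: delta_mx i j.

Lemma det_elem_mx (R : comNzRingType) m (i j : 'I_m) (r : R) :
  i != j -> \det (elem_mx i j r) = 1.
Proof.
have ltP (a b : 'I_m) : (b < a)%N -> \det (elem_mx a b r) = 1.
  move=> ltba; rewrite det_trig.
    rewrite big1 // => k _; rewrite !mxE eqxx.
    by case: eqP => [->|]; rewrite ?(gtn_eqF ltba) /= ?mulr0 ?addr0 // -val_eqE
                                   /= (gtn_eqF ltba) mulr0 addr0.
  apply/is_trig_mxP => k l ltkl; rewrite !mxE -val_eqE (ltn_eqF ltkl) add0r.
  case: eqP => [ka|]; case: eqP => [lb|]; rewrite /= ?mulr0 //.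
  by move: ltkl; rewrite ka lb ltnNge ltnW.
rewrite -val_eqE neq_ltn => /orP[ltij|]; last exact: ltP.
rewrite -det_tr /elem_mx linearD linearZ /= tr_scalar_mx trmx_delta.
exact: ltP.
Qed.

Definition gamma0 n : {perm 'I_n.+1} := perm (@ordS_inj n.+1).

(* Indices are shifted by one: for j : 'I_n, widen_ord (leqnSn n) j and
   lift ord0 j are the consecutive rows j and j + 1 in 'I_n.+1; the condition
   deg r <= 3 reads size r <= 4. *)
Definition K_gens (p n : nat) (i : 'I_n.+1) : set (SL {poly 'F_p} n.+1) :=
  [set A | exists (j : 'I_n) (r : {poly 'F_p}), (size r <= 4)%N /\
     SL_mx A = elem_mx ((gamma0 n ^+ i)%g (widen_ord (leqnSn n) j))
                       ((gamma0 n ^+ i)%g (lift ord0 j)) r].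

Definition K_poly (p n : nat) (i : 'I_n.+1) : subgroup (SL {poly 'F_p} n.+1) :=
  generated (@K_gens p n i).

Definition Fpt_mod (p s : nat) := {poly %/ ('X^s : {poly 'F_p})}.
HB.instance Definition _ p s := GRing.ComNzRing.on (Fpt_mod p s).

Definition reduction (p s : nat) : {rmorphism {poly 'F_p} -> Fpt_mod p s} :=
  in_qpoly ('X^s : {poly 'F_p}).

Definition K_mod (p n s : nat) (i : 'I_n.+1) :
    subgroup (SL (Fpt_mod p s) n.+1) :=
  image_subgroup (@SL_map _ _ (reduction p s) n.+1) (@K_poly p n i).

Definition X_complex (n p s : nat) : simplicial_complex :=
  coset_complex (@K_mod p n s).

(* Main.v *)
Require Import Defs.
From HB Require Import structures.
From mathcomp Require Import all_boot all_order all_algebra all_fingroup.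
From mathcomp Require Import boolp classical_sets.
From mathcomp Require Import cyclic zify ring.

Set Implicit Arguments.
Unset Strict Implicit.
Unset Printing Implicit Defensive.

Import GRing.Theory.
Local Open Scope group_scope.

(** Write [G] for the special linear group over [R = F_p[t]/t^s] and [L] for
the coefficient group.

Why cocycles are trivial.  A cocycle is a parallel transport between the
cosets [g K_i] and [g K_j], multiplicative on every chamber
([transport_trans]).  Consider the transformations
[(h, l) |-> (h g, l f(h))] of [G * L]; they form a group, [holonomy], that
projects to [G].  Every [K_i] lifts to it: [k] goes to the transport along the
path [h K_0], [h K_i = h k K_i], [h k K_0].  The lifts are homomorphisms and
they agree where the [K_i] meet ([walkM], [walk_indep]).  If the group [W]
generated by the lifts projects injectively to [G], the transport from a base
point depends only on the end point, and the cocycle is a coboundary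
([transport_trivial], [walk_cocycle_trivial]).  The theorem thus reduces
to this injectivity.  The hypothesis on [L] enters in the form of
[holonomy_torsion]: an element over 1 whose [p]-th power is 1 must be 1.  Those
relations of [G] that cannot be derived from the ones inside the [K_i] are
obtained from this.

Root elements.  Put the indices on a cycle.  The lift [x_ab(k)] of the
elementary matrix [e_ab(t^k)], for [k <= 3], satisfies with another one the
Steinberg relations as soon as both matrices lie in one [K_t], that is, when
the arcs from [a] to [b] and from [c] to [d] avoid a common edge of the cycle.
If two arcs cover the cycle, commutation follows from relations of rank 2 when
[p] is odd ([commute_root_strings], [cyclic_comm]).  If a commutator wraps
around the cycle, the middle index is moved by a Hall-Witt identity
([cm_assoc]) until either no wrapping is left or torsion decides
([cm_eq_of_torsion], [cyclic_cm]).

All degrees.  With at least four indices, the Steinberg relations up to a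
positive degree define root elements of every degree and imply the relations
between these ([steinberg_step], [steinberg_extend]).  In degrees at least [s]
they lie over 1 and are trivial by torsion, so that the root elements have
parameters in [R] ([ring_root_steinberg]).

The Steinberg group of [R].  The kernel of the projection restricted to these
root elements is trivial when it has no [p]-torsion ([steinberg_injective]).
The symbols, which measure how far the torus is from being commutative, are
central and bilinear; units congruent to 1 have [p]-power order and so
contribute nothing, and on [F_p] the classical argument applies: the symbol of
a generator with itself squares to 1, and the relation for [x + y = 1] kills
an odd power of it ([symbol_generator], [symbol_trivial]).  Since [R] is
local, every element has a Gauss decomposition into upper, lower, diagonal and
upper factors ([root_word_gauss]).  For an element of the kernel each factor
is trivial: the unipotent ones have [p]-power order ([unip_word_exp]), and the
diagonal one is determined by its matrix ([torus_word_inj]). *)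

(** * Commutators in groups *)

Section Commutators.
Variable G : groupType.
Implicit Types a b c d e u v w x y z : G.

Definition cm x y := x * y * x^-1 * y^-1.

Lemma cmP x y c : cm x y = c <-> x * y = c * (y * x).
Proof. by rewrite /cm; split=> [<-|->]; rewrite !gnorm. Qed.

Lemma cmE x y : x * y = cm x y * (y * x).
Proof. exact/cmP. Qed.

Lemma cm_eq1 x y : commute x y -> cm x y = 1.
Proof. by move=> xy; apply/cmP; rewrite mul1g. Qed.

Lemma cm_conjl x y : x * y * x^-1 = cm x y * y.
Proof. by rewrite /cm !gnorm. Qed.

Lemma cm_conjr x y : y * x * y^-1 = (cm x y)^-1 * x.
Proof. by rewrite /cm !gnorm. Qed.

Lemma commute_conj z x y :
  commute (z * x * z^-1) (z * y * z^-1) <-> commute x y.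
Proof.
split=> h.
  have /(congr1 (fun t => z^-1 * t * z)) := h.
  by rewrite /commute !gnorm.
have /(congr1 (fun t => z * t * z^-1)) := h.
by rewrite /commute !gnorm.
Qed.

Lemma commute_conjE x y : commute x y <-> x * y * x^-1 = y.
Proof.
split=> [->|h]; first by rewrite mulgK.
by rewrite /commute -[in RHS]h !gnorm.
Qed.

Lemma commute_cm z x y : commute z x -> commute z y -> commute z (cm x y).
Proof. by move=> zx zy; do !apply: commuteM => //; apply: commuteV. Qed.

Lemma commuteMl x y z : commute x z -> commute y z -> commute (x * y) z.
Proof.
by move=> /commute_sym xz /commute_sym yz; apply/commute_sym/commuteM.
Qed.

Lemma commuteVl x y : commute x y -> commute x^-1 y.
Proof. by move/commute_sym/commuteV/commute_sym. Qed.

Lemma commuteXl n x y : commute x y -> commute (x ^+ n) y.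
Proof. by move/commute_sym/commuteX => /(_ n) /commute_sym. Qed.

Lemma commute_cml z x y : commute x z -> commute y z -> commute (cm x y) z.
Proof.
by move=> /commute_sym xz /commute_sym yz; apply/commute_sym/commute_cm.
Qed.

Lemma conj_cm z x y :
  z * cm x y * z^-1 = cm (z * x * z^-1) (z * y * z^-1).
Proof. by rewrite /cm !gnorm. Qed.

(** This form of the Hall-Witt identity moves the middle factor of a double
commutator from the right to the left: conjugation by [x] fixes [z] and
turns [y] into [cm x y * y]. *)
Lemma cm_assoc x y z (v := cm x y) (w := cm y z) :
  commute x z -> commute w v -> commute w z -> cm x w = cm v z.
Proof.
move=> /commute_conjE xz wv wz; apply: (mulIg w).
rewrite -cm_conjl conj_cm xz cm_conjl -/v.
have -> : cm (v * y) z = v * w * z * v^-1 * z^-1 by rewrite /w /cm !gnorm.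
rewrite -wv; have cwt : commute w (cm v z) by apply: commute_cm.
by rewrite -cwt /cm !mulgA.
Qed.

Lemma cm_commuteMl v y z : commute v z -> cm (v * y) z = v * cm y z * v^-1.
Proof.
move=> vz; have vzV : v^-1 * z^-1 = z^-1 * v^-1.
  exact/commuteV/commuteVl.
by rewrite /cm invgM -!mulgA vzV.
Qed.

Lemma cmg1 x : cm x 1 = 1.
Proof. by rewrite /cm !gnorm. Qed.

Lemma cm1g x : cm 1 x = 1.
Proof. by rewrite /cm !gnorm. Qed.

Lemma cmXl x w n : commute x (cm x w) -> cm (x ^+ n) w = cm x w ^+ n.
Proof.
move=> h; have E : x ^ w^-1 = (cm x w)^-1 * x.
  by rewrite conjgE invgK mulgA cm_conjr.
apply: (mulIg (w * x ^+ n)).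
have -> : cm (x ^+ n) w * (w * x ^+ n) = x ^+ n * w by rewrite /cm !gnorm.
have := conjXg x w^-1 n; rewrite {}E expgMn ?expVgn; last first.
  exact/commute_sym/commuteV.
rewrite conjgE invgK => /(congr1 (fun t => cm x w ^+ n * (t * w))).
by rewrite !gnorm.
Qed.

Lemma conjM3 x y z : x * (y * z) * x^-1 = x * y * x^-1 * (x * z * x^-1).
Proof. by rewrite !gnorm. Qed.

End Commutators.

(** * Words in a set of generators *)

Section Words.
Variable G : groupType.
Implicit Types (P Q : G -> Prop) (g h s : G).

Inductive word P : G -> Prop :=
| word1 : word P 1
| wordM s g : P s -> word P g -> word P (s * g).

Lemma word_gen P s : P s -> word P s.
Proof. by move=> Ps; rewrite -[s]mulg1; apply: wordM => //; apply: word1. Qed.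

Lemma wordMM P g h : word P g -> word P h -> word P (g * h).
Proof.
move=> wg wh; elim: wg => [|s g' Ps _ IH]; first by rewrite mul1g.
by rewrite -mulgA; apply: wordM.
Qed.

Lemma word_sub P Q g : (forall s, P s -> word Q s) -> word P g -> word Q g.
Proof.
move=> PQ; elim=> [|s g' Ps _ IH]; first exact: word1.
by apply: wordMM => //; apply: PQ.
Qed.

Lemma word_commute P h g : (forall s, P s -> commute h s) -> word P g ->
  commute h g.
Proof.
move=> Ph; elim=> [|s g' Ps _ IH]; first exact: commute1.
by apply: commuteM => //; apply: Ph.
Qed.

Lemma wordV P g : (forall s, P s -> P s^-1) -> word P g -> word P g^-1.
Proof.
move=> PV; elim=> [|s g' Ps _ IH]; first by rewrite invg1; apply: word1.
by rewrite invgM; apply: wordMM => //; apply/word_gen/PV.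
Qed.

Lemma word_conj P h g : (forall s, P s -> word P (h * s * h^-1)) -> word P g ->
  word P (h * g * h^-1).
Proof.
move=> Ph; elim=> [|s g' Ps _ IH]; first by rewrite mulg1 mulgV; apply: word1.
by rewrite conjM3; apply: wordMM => //; apply: Ph.
Qed.

End Words.

(** * Elements of odd order *)
Section OddTorsion.
Variables (G : groupType) (p : nat).
Hypothesis p_odd : odd p.
Implicit Types a b c d e x y : G.

Lemma odd_sqrt x : x ^+ p = 1 -> x = (x ^+ 2) ^+ (p.+1)./2.
Proof.
move=> xp; rewrite -expgnA mul2n.
have -> : (p.+1)./2.*2 = p.+1 by rewrite -[RHS]odd_double_half /= p_odd.
by rewrite expgS xp mulg1.
Qed.

Lemma commute_sqr x y : x ^+ p = 1 -> commute (x ^+ 2) y -> commute x y.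
Proof. by move=> xp /(commuteXl (p.+1)./2); rewrite -odd_sqrt. Qed.

Lemma conj_commuteM x y z : commute (y^-1 * x) z -> x * z * x^-1 = y * z * y^-1.
Proof. by move/(congr1 (fun t => y * t * x^-1)); rewrite !gnorm. Qed.

(** The two hypotheses on products compute the conjugate of [c] by [b] in two
ways, whence conjugation by [b] exchanges [d * e] and [e * d].  Its square
fixes both of them, and [b] has odd order. *)
Lemma commute_conj_step a b c d (e := a * d * a^-1) :
    commute a b -> commute a c -> commute c d -> b ^+ p = 1 ->
    commute (b^-1 * a) (d * c) -> commute (b * a) (d^-1 * c) ->
  commute d e /\ commute b (d * e).
Proof.
move=> ab ac cd bp h1 h2.
have ac' : a * c * a^-1 = c by apply/commute_conjE.
have ce : commute c e by rewrite -ac'; apply/commute_conj.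
pose c1 := b * c * b^-1; pose d1 := b * d * b^-1; pose e1 := b * e * b^-1.
have cd1 : commute c1 d1 by apply/commute_conj.
have ce1 : commute c1 e1 by apply/commute_conj.
have r1 : e * c = d1 * c1.
  by have := conj_commuteM h1; rewrite !conjM3 ac'.
have r2 : d^-1 * c = e1^-1 * c1.
  move: h2; rewrite -[b in b * a]invgK => /conj_commuteM.
  rewrite conjM3 ac' invgK => /(congr1 (fun t => b * t * b^-1)).
  by rewrite /e1 /c1 /e !gnorm.
have bde : b * (d * e) * b^-1 = d1 * e1 by rewrite conjM3.
have bed : b * (e * d) * b^-1 = e1 * d1 by rewrite conjM3.
clearbody c1 d1 e1 e.
have c1E : c1 = d1^-1 * (e * c) by rewrite r1 mulKg.
have c1E' : c1 = e1 * (d^-1 * c) by rewrite r2 mulVKg.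
have ed : e * d = d1 * e1.
  have /(congr1 (fun t => d1 * t * d)) : d1^-1 * e = e1 * d^-1.
    by apply: (mulIg c); move: c1E; rewrite {1}c1E' !mulgA => ->.
  by rewrite !gnorm.
have de : d * e = e1 * d1.
  have /(congr1 (fun t => d * t * d1)) : e * d1^-1 = d^-1 * e1.
    apply: (mulgI c); rewrite !mulgA ce r1 -cd1 mulgK.
    have -> : c * d^-1 = d^-1 * c by apply: commuteV.
    by rewrite r2 -!mulgA ce1 mulKg.
  by rewrite !gnorm.
rewrite -ed in bde; rewrite -de in bed.
have cb : commute b (d * e).
  apply: commute_sqr => //; apply/commute_conjE.
  rewrite -[RHS]bed -[e * d]bde expg2 invgM.
  by rewrite !mulgA.
have := (commute_conjE b (d * e)).1 cb; rewrite bde => h.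
by split; [exact/esym | exact: cb].
Qed.

(** If [a], [u], [c] generate a group of unipotent upper triangular matrices of
rank 3, with [a] and [c] the outer simple roots, then [b] and [d] are the
commutators of [u] with [a] and with [c]; conjugating the relation
[commute a c] by [u] and by its inverse gives the two hypotheses on products.
Over a ring where 2 is invertible the two longer roots therefore commute as
a consequence of the relations of rank 2. *)
Lemma commute_of_twisted_pairs a b c d :
    commute a b -> commute a c -> commute c d -> b ^+ p = 1 -> d ^+ p = 1 ->
    commute (b^-1 * a) (d * c) -> commute (b * a) (d^-1 * c) ->
  commute b d.
Proof.
move=> ab ac cd bp dp h1 h2.
pose e := a * d * a^-1; pose e2 := a * e * a^-1.
have [de bde] : commute d e /\ commute b (d * e).
  exact: (commute_conj_step ab ac cd bp h1 h2).
(* The same step for the squares of [a] and [b] controls [d * e2]; the products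
   [d * e], [d * e2] and [e * e2] determine [d ^+ 2]. *)
have e2E : a ^+ 2 * d * (a ^+ 2)^-1 = e2 by rewrite expg2 /e2 /e !gnorm.
have [] := @commute_conj_step (a ^+ 2) (b ^+ 2) c d.
- exact: commuteX2.
- exact: commuteXl.
- by [].
- by rewrite expgnAC bp expg1n.
- rewrite -expVgn -expgMn; last exact/commuteVl/commute_sym.
  exact: commuteXl.
- rewrite -expgMn; last exact/commute_sym.
  exact: commuteXl.
rewrite e2E => de2 /(commute_sqr bp) bde2.
have bee2 : commute b (e * e2).
  have -> : e * e2 = a * (d * e) * a^-1 by rewrite conjM3.
  have <- : a * b * a^-1 = b by apply/commute_conjE.
  exact/commute_conj.
apply/commute_sym/(commute_sqr dp)/commute_sym.
have -> : d ^+ 2 = (d * e) * ((d * e2) * (e * e2)^-1).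
  clearbody e e2; rewrite expg2 invgM !mulgA mulgK -(mulgA d e d) -de.
  by rewrite !mulgA mulgK.
by apply: commuteM => //; apply: commuteM => //; apply: commuteV.
Qed.

(** With [a], [u], [c] in the matrix positions 12, 23, 34, the relation between
the positions 13 and 24 follows from the relations within the blocks 123 and
234, and from that between 12 and 34. *)
Lemma commute_root_strings a u c :
    commute a c -> commute (cm a u) a -> commute (cm a u) u ->
    commute (cm u c) u -> commute (cm u c) c ->
    cm a u ^+ p = 1 -> cm u c ^+ p = 1 ->
  commute (cm a u) (cm u c).
Proof.
move=> ac ba bu du dc bp dp; apply: (@commute_of_twisted_pairs a _ c) => //.
- by rewrite -cm_conjr -cm_conjl; apply/commute_conj.
have -> : cm a u * a = u^-1 * a * u^-1^-1.
  have /(congr1 (fun t => u^-1 * t)) : u * (cm a u * a) = a * u.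
    by rewrite mulgA -bu -mulgA [RHS]cmE.
  by rewrite mulKg mulgA invgK.
have -> : (cm u c)^-1 * c = u^-1 * c * u^-1^-1.
  have /(congr1 (fun t => u^-1 * t)) : u * ((cm u c)^-1 * c) = c * u.
    rewrite mulgA -(commuteVl du) -mulgA.
    by rewrite [u * c]cmE mulKg.
  by rewrite mulKg mulgA invgK.
by apply/commute_conj.
Qed.
End OddTorsion.

(** * Graded Steinberg relations *)

Ltac ne := first [by [] | by rewrite eq_sym | lia].

Section Graded.
Variables (G : groupType) (p : nat) (I : choiceType).
Hypothesis p_odd : odd p.
Hypothesis fourth : forall a b c : I, exists d, [&& d != a, d != b & d != c].
Implicit Types (a b c d e f : I) (i j k D : nat).

(** [x a b i] plays the part of the elementary matrix with entry [t^i] in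
position [(a, b)]. *)
Record steinberg_upto D (x : I -> I -> nat -> G) : Prop := SteinbergUpto {
  st_exp : forall a b i, a != b -> i <= D -> x a b i ^+ p = 1;
  st_comm : forall a b c d i j, a != b -> c != d -> b != c -> a != d ->
    i <= D -> j <= D -> commute (x a b i) (x c d j);
  st_cm : forall a b c i j, a != b -> b != c -> a != c -> i + j <= D ->
    cm (x a b i) (x b c j) = x a c (i + j) }.

Section Step.
Variables (D : nat) (x : I -> I -> nat -> G).
Hypotheses (D_gt0 : 0 < D) (stD : steinberg_upto D x).
Hypothesis xS : forall a c, a != c ->
  exists b, [/\ b != a, b != c & x a c D.+1 = cm (x a b 1) (x b c D)].

(* The elements of the new degree.  The hypothesis [xS] gives each of them
   through one middle index; the other middle indices and the other ways to
   share the degree are reached by [move_mid], which needs four indices. *)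
Let N a c := x a c D.+1.
Let sE := st_exp stD.
Let sC := st_comm stD.
Let sM := st_cm stD.

Let move_mid a b c d i j k : a != b -> a != c -> a != d -> b != c -> b != d ->
    c != d -> i + j <= D -> j + k <= D ->
  cm (x a b i) (x b c (j + k)) = cm (x a d (i + j)) (x d c k).
Proof.
move=> ab ac ad bc bd cd ij jk.
rewrite -(@sM b d c) -?(@sM a b d) //; try ne.
apply: cm_assoc; rewrite ?(@sM b d c) ?(@sM a b d) //; try ne.
- by apply: sC; ne.
- by apply: sC; ne.
- by apply: sC; ne.
Qed.

Let N1 a b c : a != b -> a != c -> b != c ->
  cm (x a b 1) (x b c D) = N a c.
Proof.
move=> ab ac bc; rewrite /N; have [b0 [b0a b0c ->]] := xS ac.
have [->//|bb0] := eqVneq b b0.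
by rewrite -[D]add0n (@move_mid _ _ _ b0) ?addn0 ?addn1; ne.
Qed.

Let NE a b c i j : a != b -> a != c -> b != c -> 0 < i -> 0 < j ->
  i + j = D.+1 -> cm (x a b i) (x b c j) = N a c.
Proof.
move=> + ac; elim: i j b => // -[_|i IHi] j b ab bc _ j0 ijD.
  have -> : j = D by lia.
  exact: N1.
have [d /and3P[da db dc]] := fourth a b c.
rewrite -[i.+2]addn1 -(@move_mid a d c b i.+1 1 j); try ne.
by apply: IHi; ne.
Qed.

(* An index [d] outside the two roots writes [N a c] as a commutator of two
   elements of known degree, both of which commute with the other root. *)
Let N_commD a c d e f j : a != c -> e != f -> c != e -> a != f ->
  d != a -> d != c -> d != e -> d != f -> j <= D -> commute (N a c) (x e f j).
Proof.
move=> *; rewrite -(@N1 a d c); try ne.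
by apply: commute_cml; apply: sC; ne.
Qed.

Let N_exp a c : a != c -> N a c ^+ p = 1.
Proof.
move=> ac; have [b /and3P[ba bc _]] := fourth a c c.
have [d /and3P[? ? ?]] := fourth a b c.
rewrite -(@N1 a b c); try ne.
rewrite -cmXl ?sE ?cm1g //; try ne.
by rewrite N1; try ne; apply/commute_sym/(@N_commD _ _ d); ne.
Qed.

Let N_comm a c e f j : a != c -> e != f -> c != e -> a != f -> j <= D ->
  commute (N a c) (x e f j).
Proof.
move=> ac ef ce af jD.
have [ae|nae] := eqVneq a e.
  subst e; have [d /and3P[? ? ?]] := fourth a c f.
  by apply: (@N_commD _ _ d) => //; ne.
have [cf|ncf] := eqVneq c f.
  subst f; have [d /and3P[? ? ?]] := fourth a c e.
  by apply: (@N_commD _ _ d) => //; ne.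
have N3 b k : b \in [:: e; f] -> k <= D -> commute (N a c) (x a b k).
  rewrite !inE => + kD; have [d /and3P[? ? ?]] := fourth a c b.
  by move=> /orP[]/eqP eb; subst b; apply: (@N_commD _ _ d); ne.
have N3' b k : b \in [:: e; f] -> k <= D -> commute (N a c) (x b c k).
  rewrite !inE => + kD; have [d /and3P[? ? ?]] := fourth a c b.
  by move=> /orP[]/eqP eb; subst b; apply: (@N_commD _ _ d); ne.
(* Four distinct indices, possibly the only ones.  For [j = 0] conjugate by
   [x e f 0] the expression of [N a c] through [e]; otherwise [N a c] and
   [x e f j] are the inner roots of the string [a], [e], [c], [f]. *)
case: j jD => [_|j jD].
  apply/commute_sym/commute_conjE; rewrite -{1}(@N1 a e c); try ne.
  rewrite conj_cm cm_conjr (@sM a e f); try ne.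
  have -> : x e f 0 * x e c D * (x e f 0)^-1 = x e c D.
    by apply/commute_conjE/sC; ne.
  rewrite cm_commuteMl; last by apply/commuteVl/sC; ne.
  by rewrite N1; try ne; apply/commute_conjE/commuteVl/commute_sym/N3;
    rewrite // !inE eqxx orbT.
rewrite -(@NE a e c D 1); try ne.
rewrite -[j.+1]add1n -(@sM e c f); try ne.
apply: (@commute_root_strings G p) => //.
- by apply: sC; ne.
- by rewrite NE //; try ne; apply: N3; rewrite // inE eqxx.
- by rewrite NE //; try ne; apply: N3'; rewrite // inE eqxx.
- by rewrite (@sM e c f); try ne; apply: sC; ne.
- by rewrite (@sM e c f); try ne; apply: sC; ne.
- by rewrite NE //; try ne; apply: N_exp.
- by rewrite (@sM e c f); try ne; apply: sE; ne.
Qed.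

Let N_commN a c e f : a != c -> e != f -> c != e -> a != f ->
  commute (N a c) (N e f).
Proof.
move=> ac ef ce af.
have Nd d : d != a -> d != c -> d != e -> d != f -> commute (N a c) (N e f).
  move=> *; apply: commute_sym.
  rewrite -(@N1 a d c); try ne.
  by apply: commute_cm; apply: N_comm; ne.
have [ae|nae] := eqVneq a e.
  by have [d /and3P[? ? ?]] := fourth a c f; apply: (Nd d); rewrite -?ae.
have [cf|ncf] := eqVneq c f.
  by have [d /and3P[? ? ?]] := fourth a c e; apply: (Nd d); rewrite -?cf.
rewrite -(@NE a e c D 1) -?(@NE e c f 1 D); try ne.
apply: (@commute_root_strings G p) => //; rewrite ?NE //; try ne.
- by apply: sC; ne.
- by apply: N_comm; ne.
- by apply: N_comm; ne.
- by apply: N_comm; ne.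
- by apply: N_comm; ne.
- by apply: N_exp.
- by apply: N_exp.
Qed.

Let N_cml a b c : a != b -> a != c -> b != c -> cm (x a b 0) (N b c) = N a c.
Proof.
move=> ab ac bc; have [d /and3P[? ? ?]] := fourth a b c.
rewrite -(@N1 b d c) -?(@N1 a d c); try ne.
rewrite -[1%N in RHS]add0n -(@sM a b d); try ne.
apply: cm_assoc; rewrite ?(@sM a b d) ?N1 //; try ne.
- by apply: sC; ne.
- by apply: N_comm; ne.
- by apply: N_comm; ne.
Qed.

Let N_cmr a b c : a != b -> a != c -> b != c -> cm (N a b) (x b c 0) = N a c.
Proof.
move=> ab ac bc; have [d /and3P[? ? ?]] := fourth a b c.
rewrite -(@NE a d b D 1) -?(@NE a d c D 1); try ne.
rewrite -[1%N in RHS]addn0 -(@sM d b c); try ne.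
apply/esym/cm_assoc; rewrite ?(@sM d b c) ?NE //; try ne.
- by apply: sC; ne.
- by apply/commute_sym/N_comm; ne.
- by apply: sC; ne.
Qed.

(** The relations of degree [D.+1] hold as soon as the elements of that degree
are commutators of elements of degrees 1 and [D] through some middle index. *)
Lemma steinberg_step : steinberg_upto D.+1 x.
Proof.
split=> [a b i ab|a b c d i j ab cd bc ad|a b c i j ab bc ac].
- by rewrite leq_eqVlt ltnS => /orP[/eqP->|]; [apply: N_exp | apply: sE].
- rewrite leq_eqVlt ltnS => /orP[/eqP->|iD]; rewrite leq_eqVlt ltnS
    => /orP[/eqP->|jD].
  + exact: N_commN.
  + exact: N_comm.
  + by apply/commute_sym/N_comm; ne.
  + exact: sC.
- rewrite leq_eqVlt ltnS => /orP[/eqP ijD|]; last exact: sM.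
  rewrite ijD; case: i ijD => [|i] ijD.
    by rewrite add0n in ijD; rewrite ijD; apply: N_cml.
  case: j ijD => [|j] ijD; last by apply: NE; ne.
  by rewrite addn0 in ijD; rewrite ijD; apply: N_cmr.
Qed.

End Step.

Lemma steinberg_uptoW D E x :
  E <= D -> steinberg_upto D x -> steinberg_upto E x.
Proof. by move=> ED [h1 h2 h3]; split=> *; [apply: h1|apply: h2|apply: h3]; lia. Qed.

Lemma eq_steinberg_upto D x y : (forall a b i, i <= D -> x a b i = y a b i) ->
  steinberg_upto D x -> steinberg_upto D y.
Proof.
move=> e [h1 h2 h3]; split=> *; rewrite -?e; try lia.
- exact: h1.
- exact: h2.
- exact: h3.
Qed.

Fixpoint graded_extension D (x : I -> I -> nat -> G) (mid : I -> I -> I) n :=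
  if n is k.+1 then fun a c => if k < D then x a c k.+1 else
    cm (x a (mid a c) 1%N) (graded_extension D x mid k (mid a c) c)
  else fun a c => x a c 0.

(** The relations force the elements of degree above [D], one degree after the
other, and [steinberg_step] shows that this choice is consistent. *)
Lemma steinberg_extend D x : 0 < D -> steinberg_upto D x ->
  exists y, (forall a b i, i <= D -> y a b i = x a b i) /\
            (forall E, steinberg_upto E y).
Proof.
move=> D0 stx.
pose mid a c := xchoose (fourth a a c).
pose y a c k := graded_extension D x mid k a c.
have yx a b i : i <= D -> y a b i = x a b i.
  by rewrite /y; case: i => //= i ->.
exists y; split=> // E; have [ED|] := leqP E D.
  apply: (steinberg_uptoW ED); apply: eq_steinberg_upto stx => a b i iD.
  by rewrite yx.
elim: E => // E IHE; rewrite ltnS leq_eqVlt => DE.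
have stE : steinberg_upto E y.
  case/orP: DE => [/eqP<-|/IHE//]; apply: eq_steinberg_upto stx => a b i iD.
  by rewrite yx.
apply: steinberg_step => //; first by case/orP: DE; lia.
move=> a c ac; exists (mid a c).
have /and3P[? ? ?] : [&& mid a c != a, mid a c != a & mid a c != c].
  exact: (xchooseP (fourth a a c)).
split=> //; rewrite [in LHS]/y /= ifF; last by case/orP: DE; lia.
by rewrite yx.
Qed.

End Graded.

(** * Relations along a cycle *)

Section CyclicOrder.
Variable m : nat.
Implicit Types a b t e : 'I_m.

(** The roots [(a, b)] with [cyc_lt t a b] are the positive ones for the linear
order that arises when the cycle is cut just before [t]; these are the roots of
the subgroup of index [t] of the coset complex. *)
Definition cyc_pos (t a : 'I_m) : nat := if t <= a then a - t else a + m - t.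
Definition cyc_lt t a b := cyc_pos t a < cyc_pos t b.

Lemma cyc_posP a k : k < m -> exists e, cyc_pos a e = k.
Proof.
move=> km; have am := ltn_ord a.
have lt_e : (if a + k < m then a + k else a + k - m) < m by case: ifP; lia.
by exists (Ordinal lt_e); rewrite /cyc_pos /=; do 2?case: ifP; lia.
Qed.

End CyclicOrder.

Section Cyclic.
Variables (G H : groupType) (pi : UMagmaMorphism.type G H) (p m D : nat).
Hypothesis p_odd : odd p.
Hypothesis m_ge4 : 3 < m.
Hypothesis torsion : forall g, pi g = 1 -> g ^+ p = 1 -> g = 1.
Implicit Types (a b c d e t : 'I_m) (i j k : nat).

Variable x : 'I_m -> 'I_m -> nat -> G.
Hypothesis xE : forall a b i, a != b -> i <= D -> x a b i ^+ p = 1.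
Hypothesis xC : forall t a b c d i j, cyc_lt t a b -> cyc_lt t c d ->
  b != c -> a != d -> i <= D -> j <= D -> commute (x a b i) (x c d j).
Hypothesis xM : forall t a b c i j, cyc_lt t a b -> cyc_lt t b c ->
  i + j <= D -> cm (x a b i) (x b c j) = x a c (i + j).
Hypothesis xpi : forall a b c i j, a != b -> b != c -> a != c -> i + j <= D ->
  cm (pi (x a b i)) (pi (x b c j)) = pi (x a c (i + j)).

Ltac ordbounds :=
  repeat match goal with a : 'I_m |- _ =>
    lazymatch goal with
    | _ : is_true (nat_of_ord a < m) |- _ => fail
    | _ => pose proof (ltn_ord a) end end.
Ltac cyc :=
  repeat match goal with h : is_true (_ != _) |- _ => revert h
                       | h : is_true (cyc_lt _ _ _) |- _ => revert h
                       | h : cyc_lt _ _ _ = false |- _ => revert h end;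
  ordbounds; try rewrite -!val_eqE; rewrite /cyc_lt /cyc_pos /=;
  repeat case: ifP; intros; lia.

(** Two arcs that cover the cycle meet it in the order [a], [d], [c], [b].  Then
[(a, b)] and [(c, d)] are the inner roots of the string [a], [c], [b], [d]; any
two of its simple roots are positive for a common linear order. *)
Lemma cyclic_comm a b c d i j : a != b -> c != d -> b != c -> a != d ->
  i <= D -> j <= D -> commute (x a b i) (x c d j).
Proof.
move=> ab cd bc ad iD jD.
have [acd|nacd] := boolP (cyc_lt a c d).
  by apply: (@xC a) => //; cyc.
have [cab|ncab] := boolP (cyc_lt c a b).
  by apply: (@xC c) => //; cyc.
have [dc cb] : cyc_lt a d c /\ cyc_lt a c b.
  by split; move: nacd ncab; cyc.
have acE : cm (x a c i) (x c b 0) = x a b i.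
  by rewrite (@xM a) ?addn0 //; cyc.
have cdE : cm (x c b 0) (x b d j) = x c d j.
  by rewrite (@xM c) //; cyc.
rewrite -acE -cdE; apply: (@commute_root_strings G p) => //; rewrite ?acE ?cdE.
- by apply: (@xC b) => //; cyc.
- by apply: (@xC a) => //; cyc.
- by apply: (@xC a) => //; cyc.
- by apply: (@xC c) => //; cyc.
- by apply: (@xC c) => //; cyc.
- exact: xE.
- exact: xE.
Qed.

(** Under these commutation hypotheses the quotient of [cm y w] by [z] is a
[p]-torsion element of the kernel. *)
Lemma cm_eq_of_torsion (y w z : G) :
    cm (pi y) (pi w) = pi z -> commute z y -> commute z w -> z ^+ p = 1 ->
    cm y w ^+ p = 1 -> cm y w = z.
Proof.
move=> piz zy zw zp ywp; apply: divg1_eq; apply: torsion.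
  by rewrite gmulfF /cm !(gmulfM, gmulfV) -/(cm _ _) piz divgg.
rewrite expgnFl ?ywp ?zp ?invg1 ?mulg1 //.
exact/commute_sym/commute_cm.
Qed.

(** [cm y w] is the product of a conjugate of [w] with [w^-1]; both factors have
exponent [p], and they commute. *)
Lemma exp_cml (y w : G) : y ^+ p = 1 -> w ^+ p = 1 ->
  commute w (y * w * y^-1) -> cm y w ^+ p = 1.
Proof.
move=> yp wp h; have -> : cm y w = (y * w * y^-1) * w^-1 by [].
rewrite expgnFl ?wp ?invg1 ?mulg1; last exact/commute_sym.
have -> : y * w * y^-1 = w ^ y^-1 by rewrite conjgE invgK mulgA.
by rewrite -conjXg wp conj1g.
Qed.

Lemma exp_cmr (y w : G) : y ^+ p = 1 -> w ^+ p = 1 ->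
  commute y (w * y * w^-1) -> cm y w ^+ p = 1.
Proof.
move=> yp wp h; have -> : cm y w = (cm w y)^-1 by rewrite /cm !gnorm.
by rewrite expVgn exp_cml ?invg1.
Qed.

(** For indices in the wrapped order [a], [c], [b] the argument is by induction
on the distance from [a] to [c].  An index [e] between them can replace [b] as
the middle index.  If [c] comes just after [a], the value is known from the
projection up to torsion; that the commutator has exponent [p] is seen by
factoring through a fourth index, on whichever side of [b] it lies. *)
Lemma cyclic_cm a b c i j : a != b -> b != c -> a != c -> i + j <= D ->
  cm (x a b i) (x b c j) = x a c (i + j).
Proof.
move=> ab bc ac ijD.
have [abc|nabc] := boolP (cyc_lt a b c).
  by apply: (@xM a) => //; cyc.
have acb : cyc_lt a c b by move: nabc; cyc.
clear nabc; have [n le_n] := ubnP (cyc_pos a c).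
elim: n c j bc ac acb le_n ijD => // n IHn c j bc ac acb le_n ijD.
have iD : i <= D by lia.
have jD : j <= D by lia.
have [ac1|ac1] := leqP (cyc_pos a c) 1; last first.
  have [e ae1] : exists e, cyc_pos a e = 1%N by apply: cyc_posP; lia.
  have ebnd : [&& a != e, b != e, c != e, cyc_lt a e c & cyc_lt a e b].
    by move: ae1 ac1 acb; cyc.
  case/and5P: ebnd => ae be ce aec aeb.
  have bcE : cm (x b e 0) (x e c j) = x b c j by rewrite (@xM b) //; cyc.
  have aeE : cm (x a b i) (x b e 0) = x a e i.
    by rewrite IHn ?addn0 //; try cyc; move: aec le_n; rewrite /cyc_lt; lia.
  have -> : cm (x a b i) (x b c j) = cm (x a e i) (x e c j).
    rewrite -bcE -aeE; apply: cm_assoc; rewrite ?bcE ?aeE.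
    - by apply: cyclic_comm => //; ne.
    - by apply: cyclic_comm => //; ne.
    - by apply: cyclic_comm => //; ne.
  by rewrite (@xM a) //; cyc.
have [e eP] : exists e, [&& a != e, b != e & c != e].
  have [e2 e2P] := @cyc_posP m a 2 (ltnW m_ge4).
  have [e3 e3P] := @cyc_posP m a 3 m_ge4.
  case: (eqVneq b e2) => [be2|be2]; [exists e3|exists e2].
    by rewrite be2; move: e2P e3P ac1; cyc.
  by move: e2P ac1; cyc.
case/and3P: eP => ae be ce.
apply: cm_eq_of_torsion; rewrite ?xpi ?xE //; try lia.
- by apply: cyclic_comm => //; ne.
- by apply: cyclic_comm => //; ne.
have [abe|nabe] := boolP (cyc_lt a b e).
- apply: exp_cml; rewrite ?xE //.
  have <- : cm (x b e 0) (x e c j) = x b c j by rewrite (@xM b) //; cyc.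
  rewrite [X in commute _ X]conj_cm cm_conjl (@xM a a b e) //; try cyc.
  have -> : x a b i * x e c j * (x a b i)^-1 = x e c j.
    by apply/commute_conjE/cyclic_comm => //; ne.
  rewrite (@xM b b e c) //; try cyc.
  by apply: commute_cm; [apply: commuteM|]; apply: cyclic_comm => //; ne.
- have aeb : [&& cyc_lt a e b, cyc_lt a c e & cyc_lt e b c].
    by move: ac1 acb nabe; cyc.
  case/and3P: aeb => aeb ace ebc.
  apply: exp_cmr; rewrite ?xE //.
  have <- : cm (x a e i) (x e b 0) = x a b i by rewrite (@xM a) ?addn0 //; cyc.
  rewrite [X in commute _ X]conj_cm.
  have -> : x b c j * x a e i * (x b c j)^-1 = x a e i.
    by apply/commute_conjE/cyclic_comm => //; ne.
  rewrite cm_conjr (@xM e e b c) //; try cyc.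
  rewrite (@xM a a e b) //; try cyc; rewrite addn0.
  apply: commute_cm; last apply: commuteM; try apply: commuteV;
    by apply: cyclic_comm => //; ne.
Qed.

Theorem steinberg_of_cyclic : steinberg_upto p D x.
Proof. by split; [exact: xE|exact: cyclic_comm|exact: cyclic_cm]. Qed.

End Cyclic.

(** * Weyl and torus elements in Steinberg groups *)

Lemma elem_mulmx (R : comNzRingType) m n (a b : 'I_m) (r : R) (A : 'M_(m, n)) i j :
  (elem_mx a b r *m A)%R i j = (A i j + (i == a)%:R * (r * A b j))%R.
Proof.
rewrite /elem_mx mulmxDl mul1mx -scalemxAl !mxE; congr (_ + _)%R.
rewrite (bigD1 b) //= big1 ?addr0 => [|k kb].
  by rewrite !mxE eqxx andbT; ring.
by rewrite !mxE (negPf kb) andbF mul0r.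
Qed.

Lemma commute_cancel (G : groupType) (g h : G) : commute h g -> g^-1 * h * g = h.
Proof. by move=> hg; rewrite -mulgA hg mulKg. Qed.

Section Steinberg.
Variables (R : comUnitRingType) (m : nat) (G : groupType).
Variables (pi : UMagmaMorphism.type G (SL R m)) (u : 'I_m -> 'I_m -> R -> G).
Implicit Types (a b c d e : 'I_m) (x y z r v : R) (g : G) (t : 'I_m -> R).

Record steinberg : Prop := Steinberg {
  st_add : forall a b x y, a != b -> u a b (x + y)%R = u a b x * u a b y;
  st_commute : forall a b c d x y, a != b -> c != d -> b != c -> a != d ->
    commute (u a b x) (u c d y);
  st_cmR : forall a b c x y, a != b -> b != c -> a != c ->
    cm (u a b x) (u b c y) = u a c (x * y)%R;
  st_pi : forall a b x, a != b -> SL_mx (pi (u a b x)) = elem_mx a b x }.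

Hypothesis third : forall a b, exists c, (c != a) && (c != b).
Hypothesis st : steinberg.

Let uD := st_add st.
Let uC := st_commute st.
Let uM := st_cmR st.

Lemma root0 a b : a != b -> u a b 0%R = 1.
Proof. by move=> ab; apply: (mulgI (u a b 0%R)); rewrite -uD // addr0 mulg1. Qed.

Lemma rootN a b x : a != b -> u a b (- x)%R = (u a b x)^-1.
Proof.
by move=> ab; apply: (mulgI (u a b x)); rewrite -uD // subrr root0 // divgg.
Qed.

Lemma root_conjl a b c x y : a != b -> b != c -> a != c ->
  u a b x * u b c y * (u a b x)^-1 = u a c (x * y)%R * u b c y.
Proof. by move=> *; rewrite cm_conjl uM. Qed.

Lemma root_conjr a b c x y : a != b -> b != c -> a != c ->
  u b c y * u a b x * (u b c y)^-1 = u a c (- (x * y))%R * u a b x.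
Proof. by move=> *; rewrite cm_conjr uM // rootN. Qed.

Lemma root_conj_fix a b c d x y : a != b -> c != d -> b != c -> a != d ->
  u a b x * u c d y * (u a b x)^-1 = u c d y.
Proof. by move=> *; apply/commute_conjE/uC. Qed.

(** It lies over the monomial matrix with entry [x] in position [(a, b)] and
[- x^-1] in position [(b, a)]. *)
Definition weyl a b x := u a b x * u b a (- x^-1)%R * u a b x.

Lemma weyl_conjE a b x g : weyl a b x * g * (weyl a b x)^-1 =
  u a b x * (u b a (- x^-1)%R * (u a b x * g * (u a b x)^-1) *
  (u b a (- x^-1)%R)^-1) * (u a b x)^-1.
Proof. by rewrite /weyl !invgM !mulgA. Qed.

Lemma weylV a b x : a != b -> (weyl a b x)^-1 = weyl a b (- x)%R.
Proof.
by move=> ab; rewrite /weyl !invgM mulgA invrN opprK !rootN ?invgK //; ne.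
Qed.

Section WeylConj.
Variables (a b c : 'I_m) (x : R).
Hypotheses (ab : a != b) (ca : c != a) (cb : c != b) (xU : x \is a GRing.unit).

Let ba : b != a. Proof. by rewrite eq_sym. Qed.
Let ac : a != c. Proof. by rewrite eq_sym. Qed.
Let bc : b != c. Proof. by rewrite eq_sym. Qed.

Local Notation w := (weyl a b x).

Lemma weyl_ac y : w * u a c y * w^-1 = u b c (- (x^-1 * y))%R.
Proof.
rewrite weyl_conjE root_conj_fix // root_conjl // (conjM3 (u a b _)).
rewrite root_conjl // root_conj_fix //.
have -> : (x * (- x^-1 * y) = - y)%R by rewrite mulNr mulrN mulVKr.
rewrite (@rootN a c y) // commute_cancel; last by apply: uC.
by rewrite mulNr.
Qed.

Lemma weyl_bc y : w * u b c y * w^-1 = u a c (x * y)%R.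
Proof.
rewrite weyl_conjE root_conjl // (conjM3 (u b a _)) root_conjl // root_conj_fix //.
have -> : (- x^-1 * (x * y) = - y)%R by rewrite mulNr mulKr.
rewrite (@rootN b c y) // commute_cancel; last by apply: uC.
by rewrite root_conj_fix.
Qed.

Lemma weyl_ca y : w * u c a y * w^-1 = u c b (- (y * x))%R.
Proof.
rewrite weyl_conjE root_conjr // (conjM3 (u b a _)) root_conjr // root_conj_fix //.
have -> : (- (- (y * x) * - x^-1) = - y)%R by rewrite mulrNN mulrK.
rewrite (@rootN c a y) // commute_cancel; last by apply: uC.
by rewrite root_conj_fix.
Qed.

Lemma weyl_cb y : w * u c b y * w^-1 = u c a (y * x^-1)%R.
Proof.
rewrite weyl_conjE root_conj_fix // root_conjr // (conjM3 (u a b _)).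
rewrite root_conjr // root_conj_fix //.
have -> : (- (- (y * - x^-1) * x) = - y)%R by rewrite mulrN opprK mulrVK.
rewrite (@rootN c b y) // commute_cancel; last by apply: uC.
by rewrite mulrN opprK.
Qed.

(** The roots of the rank one group itself are reached through a third index,
by writing them as commutators. *)
Lemma weyl_ab y : w * u a b y * w^-1 = u b a (- (x^-1 * y * x^-1))%R.
Proof.
have -> : u a b y = cm (u a c y) (u c b 1%R) by rewrite uM ?mulr1.
by rewrite conj_cm weyl_ac weyl_cb uM // mul1r mulNr.
Qed.

Lemma weyl_ba y : w * u b a y * w^-1 = u a b (- (x * y * x))%R.
Proof.
have -> : u b a y = cm (u b c y) (u c a 1%R) by rewrite uM ?mulr1.
by rewrite conj_cm weyl_bc weyl_ca uM // mul1r mulrN.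
Qed.

End WeylConj.

Lemma weyl_fix a b c d x y : a != b -> c != d -> c != a -> c != b ->
  d != a -> d != b -> weyl a b x * u c d y * (weyl a b x)^-1 = u c d y.
Proof.
by move=> *; apply/commute_conjE; do 2?[apply: commuteMl]; apply: uC; ne.
Qed.

(** A Weyl element commutes with itself, and conjugation by it exchanges the two
opposite root subgroups of which it is made. *)
Lemma weyl_sym a b x : a != b -> x \is a GRing.unit ->
  weyl a b x = weyl b a (- x^-1)%R.
Proof.
move=> ab xU; have [c /andP[ca cb]] := third a b.
have -> : weyl a b x = weyl a b x * weyl a b x * (weyl a b x)^-1.
  by rewrite mulgK.
rewrite {2}/weyl !conjM3 (weyl_ab ab ca cb xU) (weyl_ba ab ca cb xU).
by rewrite mulVr // mul1r mulrN mulrV // mulN1r opprK /weyl invrN invrK opprK.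
Qed.

(** It lies over the diagonal matrix with entries [x] at [a] and [x^-1] at
[b], which [tor_weight] lists. *)
Definition tor a b x := weyl a b x * weyl a b (-1)%R.

Lemma tor1 a b : a != b -> tor a b 1%R = 1.
Proof. by move=> ab; rewrite /tor -weylV // mulgV. Qed.

Lemma torV_weyl a b x : a != b ->
  (tor a b x)^-1 = weyl a b 1%R * weyl a b (- x)%R.
Proof. by move=> ab; rewrite /tor invgM !weylV // opprK. Qed.

Lemma tor_div a b x y : a != b ->
  tor a b x * (tor a b y)^-1 = weyl a b x * weyl a b (- y)%R.
Proof.
by move=> ab; rewrite torV_weyl // /tor -(weylV 1%R) // divgKA.
Qed.

Definition tor_weight a b x c : R :=
  if c == a then x else if c == b then x^-1%R else 1%R.

(** [g] behaves like the diagonal matrix with entries [t], both in [G] and after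
projection. *)
Record torus g t : Prop := Torus {
  torus_unit : forall c, t c \is a GRing.unit;
  torus_conj : forall c d y, c != d ->
    g * u c d y * g^-1 = u c d (t c * y * (t d)^-1)%R;
  torus_mx : forall (A : 'M[R]_m) c d,
    (SL_mx (pi g) *m A)%R c d = (t c * A c d)%R }.

Lemma torus1 : torus 1 (fun=> 1%R).
Proof.
split=> [c|c d y cd|A c d]; first exact: unitr1.
  by rewrite mul1g invg1 mulg1 mul1r divr1.
by rewrite gmulf1 mul1mx mul1r.
Qed.

Lemma torusM g h t t' : torus g t -> torus h t' ->
  torus (g * h) (fun c => t c * t' c)%R.
Proof.
move=> [tU tC tA] [sU sC sA]; split=> [c|c d y cd|A c d].
- by rewrite unitrMl.
- have -> : g * h * u c d y * (g * h)^-1 = g * (h * u c d y * h^-1) * g^-1.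
    by rewrite invgM !mulgA.
  by rewrite sC // tC // invrM //; congr u; rewrite !mulrA.
- by rewrite gmulfM /= -mulmxA tA sA mulrA.
Qed.

Lemma torusV g t : torus g t -> torus g^-1 (fun c => (t c)^-1)%R.
Proof.
move=> [tU tC tA]; split=> [c|c d y cd|A c d]; first by rewrite unitrV.
  apply: (mulgI g); apply: (mulIg g^-1).
  have -> : g * (g^-1 * u c d y * g^-1^-1) * g^-1 = u c d y.
    by rewrite invgK !mulgA mulgV mul1g mulgK.
  rewrite tC // invrK !mulrA mulrV // mul1r mulrK //.
have := tA (SL_mx (pi g^-1%g) *m A)%R c d; rewrite mulmxA.
have -> : (SL_mx (pi g) *m SL_mx (pi g^-1%g))%R = 1%:M%R.
  by rewrite gmulfV; have /(congr1 (@SL_mx _ _)) := mulgV (pi g).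
by rewrite mul1mx => ->; rewrite mulKr.
Qed.

Lemma weyl_mx a b x (A : 'M[R]_m) c d : a != b -> x \is a GRing.unit ->
  (SL_mx (pi (weyl a b x)) *m A)%R c d =
  (if c == a then x * A b d else if c == b then - (x^-1 * A a d) else A c d)%R.
Proof.
move=> ab xU; have ba : b != a by ne.
rewrite /weyl !gmulfM /= !(st_pi st) // -!mulmxA !elem_mulmx.
rewrite !eqxx (negPf ba) !mul0r !mul1r !addr0.
case: eqP => [->|_]; last case: eqP => [->|_]; rewrite ?(negPf ab) ?eqxx.
- rewrite mulNr mulrDr mulKr // mulr1n mulr0n mul0r !mul1r addr0 opprD.
  have -> : (x * (A b d + (- (x^-1 * A a d) - A b d)) = - A a d)%R.
    by rewrite addrC subrK mulrN mulVKr.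
  by rewrite addrAC subrr add0r.
- rewrite mulNr mulrDr mulKr // mulr1n mulr0n !mul0r !mul1r !addr0 opprD.
  by rewrite addrC subrK.
- by rewrite mulr0n !mul0r !addr0.
Qed.

Lemma tor_torus a b x : a != b -> x \is a GRing.unit ->
  torus (tor a b x) (tor_weight a b x).
Proof.
move=> ab xU; have ba : b != a by ne.
have N1U : (-1 : R)%R \is a GRing.unit by rewrite unitrN1.
have wwE g : tor a b x * g * (tor a b x)^-1 =
  weyl a b x * (weyl a b (-1)%R * g * (weyl a b (-1)%R)^-1) * (weyl a b x)^-1.
  by rewrite /tor invgM !mulgA.
have [e /andP[ea eb]] := third a b.
split=> [c|c d y cd|A c d]; rewrite /tor_weight.
- by case: ifP => // _; case: ifP; rewrite ?unitrV ?unitr1.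
- rewrite wwE; have [ca|ca] := eqVneq c a; have [da|da] := eqVneq d a.
  + by rewrite ca da eqxx in cd.
  + subst c; have [db|db] := eqVneq d b.
      subst d; rewrite (weyl_ab ab ea eb N1U) (weyl_ba ab ea eb xU) invrK.
      by congr u; rewrite invrN invr1; ring.
    rewrite (weyl_ac ab da db N1U) (weyl_bc ab da db xU) invr1 mulr1.
    by congr u; rewrite invrN invr1; ring.
  + subst d; have [cb|cb] := eqVneq c b.
      subst c; rewrite (weyl_ba ab ea eb N1U) (weyl_ab ab ea eb xU).
      by congr u; ring.
    rewrite (weyl_ca ab ca cb N1U) (weyl_cb ab ca cb xU).
    by congr u; ring.
  + have [cb|cb] := eqVneq c b; have [db|db] := eqVneq d b.
    * by rewrite cb db eqxx in cd.
    * subst c; rewrite (weyl_bc ab da db N1U) (weyl_ac ab da db xU) invr1.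
      by congr u; ring.
    * subst d; rewrite (weyl_cb ab ca cb N1U) (weyl_ca ab ca cb xU).
      by congr u; rewrite invrN invr1 invrK; ring.
    * by rewrite !weyl_fix //; congr u; rewrite invr1; ring.
- rewrite /tor gmulfM /= -mulmxA !weyl_mx // eqxx (negPf ba) eqxx.
  case: eqP => [->|_]; first by rewrite invrN invr1; ring.
  case: eqP => [->|_]; last by rewrite mul1r.
  by ring.
Qed.

Lemma weyl_move a b x z : a != b -> x \is a GRing.unit ->
  weyl a b x * u a b z = u b a (- (x^-1 * z * x^-1))%R * weyl a b x.
Proof.
move=> ab xU; have [e /andP[ea eb]] := third a b.
by rewrite -(weyl_ab ab ea eb xU) mulgVK.
Qed.

Lemma weyl_root a b x : a != b ->
  u a b x = weyl a b x * u a b (- x)%R * u b a (x^-1)%R.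
Proof.
move=> ab; have ba : b != a by ne.
by rewrite /weyl !rootN // mulgK mulgVK.
Qed.

Lemma root_weyl_root a b x : a != b -> x \is a GRing.unit ->
  u b a x = u a b (x^-1)%R * weyl b a x * u a b (x^-1)%R.
Proof.
move=> ab xU; have ba : b != a by ne.
rewrite weyl_sym // /weyl invrN invrK opprK !rootN //.
by rewrite !mulgA mulgV mul1g mulgVK.
Qed.

(** The identity of two by two matrices that turns an upper times a lower factor
into lower, diagonal, upper.  The root that is a unit gives the Weyl element,
hence two variants; their diagonal factors are different words, and comparing
them is what makes the symbol of [x] and [1 - x] trivial. *)
Lemma gauss_unitl a b x y v : a != b -> x \is a GRing.unit ->
    v \is a GRing.unit -> v = (1 + x * y)%R ->
  u a b x * u b a y = u b a (y * v^-1)%R *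
    (weyl a b x * weyl a b (- (x * v^-1))%R) * u a b (x * v^-1)%R.
Proof.
move=> ab xU vU vE; have ba : b != a by ne.
have qE : (x^-1 + y)%R = (x^-1 * v)%R by rewrite vE mulrDr mulr1 mulKr.
have qU : (x^-1 * v)%R \is a GRing.unit by rewrite unitrM unitrV xU.
have qV : (x^-1 * v)^-1%R = (x * v^-1)%R by rewrite invrM ?unitrV // invrK mulrC.
rewrite (weyl_root x ab) -mulgA -uD // qE (root_weyl_root ab qU) qV.
rewrite (weyl_sym ba qU) qV.
have := weyl_move (- x + x * v^-1)%R ab xU; rewrite uD //.
move: (weyl a b x) (weyl a b (- (x * v^-1))%R) => w1 w2 wE.
rewrite !mulgA -(mulgA w1) wE; congr (u _ _ _ * _ * _ * _).
have -> : y = (x^-1 * (v - 1))%R by rewrite vE addrAC subrr add0r mulKr.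
have xV := mulrV xU; have vV := mulrV vU.
by ring: xV vV.
Qed.

Lemma gauss_unitr a b x y v : a != b -> y \is a GRing.unit ->
    v \is a GRing.unit -> v = (1 + x * y)%R ->
  u a b x * u b a y = u b a (y * v^-1)%R *
    (weyl a b (- y^-1)%R * weyl a b (y^-1 * v^-1)%R) * u a b (x * v^-1)%R.
Proof.
move=> ab yU vU vE; have ba : b != a by ne.
have gE : (x + y^-1)%R = (v * y^-1)%R by rewrite vE mulrDl mul1r mulrK // addrC.
have qU : (- (y * v))%R \is a GRing.unit by rewrite unitrN unitrM yU.
have qV : ((- (y * v))^-1 = - (y^-1 * v^-1))%R by rewrite invrN invrM // mulrC.
have [e /andP[ea eb]] := third a b.
have wm z : weyl b a y * u a b z = u b a (- (y * z * y))%R * weyl b a y.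
  by rewrite -(weyl_ba ba eb ea yU) mulgVK.
have wz z : u a b z * weyl b a y = weyl b a y * u b a (- (y * z * y))%R.
  have NyU : (- y)%R \is a GRing.unit by rewrite unitrN.
  have := weyl_ba ba eb ea NyU z; rewrite -weylV // invgK => E.
  by apply: (mulgI (weyl b a y)^-1); rewrite mulgA E mulKg; congr u; ring.
have -> : weyl a b (y^-1 * v^-1)%R = weyl b a (- (y * v))%R.
  by rewrite [RHS]weyl_sym // qV opprK.
have -> : weyl a b (- y^-1)%R = weyl b a y by rewrite [RHS]weyl_sym.
rewrite {1}(root_weyl_root ab yU).
have := root_weyl_root ab qU; rewrite qV.
move: (weyl b a y) (weyl b a (- (y * v)))%R wm wz => w1 w2 wm wz yvE.
rewrite !mulgA -uD // gE wz.
have -> : (- (y * (v * y^-1) * y) = - (y * v))%R.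
  by rewrite -!mulrA mulVr // mulr1.
rewrite yvE !mulgA wm -!mulgA -uD //.
have yV := mulrV yU; have vV := mulrV vU.
have -> : x = ((v - 1) * y^-1)%R by rewrite vE addrAC subrr add0r mulrK.
by congr (u _ _ _ * (_ * (_ * u _ _ _))); ring: yV vV.
Qed.

(** ** Triviality of the symbols *)

Definition central g := forall a b x, a != b -> commute g (u a b x).

Lemma central_weyl g a b x : central g -> a != b -> commute g (weyl a b x).
Proof. by move=> gC ab; do 2?[apply: commuteM]; apply: gC; ne. Qed.

Lemma central_tor g a b x : central g -> a != b -> commute g (tor a b x).
Proof. by move=> gC ab; apply: commuteM; apply: central_weyl. Qed.

Lemma torus_kernel g t : torus g t -> (forall c, t c = 1%R) ->
  central g /\ pi g = 1.
Proof.
move=> [_ gC gA] t1; split=> [a b x ab|].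
  by apply/commute_conjE; rewrite gC // !t1 mul1r divr1.
apply: val_inj; apply/matrixP => c d.
by have := gA 1%:M%R c d; rewrite mulmx1 t1 mul1r.
Qed.

Lemma torus_cm g h t t' : torus g t -> torus h t' ->
  central (cm g h) /\ pi (cm g h) = 1.
Proof.
move=> gT hT; have gU := torus_unit gT; have hU := torus_unit hT.
have := torusM (torusM (torusM gT hT) (torusV gT)) (torusV hT).
move/torus_kernel; apply=> c.
by rewrite mulrAC mulrK ?mulrV.
Qed.

Lemma torus_conj_weyl g t c d y : torus g t -> c != d -> y \is a GRing.unit ->
  g * weyl c d y * g^-1 = weyl c d (t c * (t d)^-1 * y)%R.
Proof.
move=> gT cd yU; have dc : d != c by ne.
have tU := torus_unit gT; have tC := torus_conj gT.
rewrite /weyl !conjM3 !tC // [in RHS]invrM ?unitrM ?unitrV ?tU //.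
rewrite [in RHS]invrM ?unitrV ?tU // invrK.
by congr (u _ _ _ * u _ _ _ * u _ _ _); ring.
Qed.

(** Conjugation multiplies the parameters of the two Weyl elements in [tor] by
the same unit; hence [tor] is multiplicative up to a symbol. *)
Lemma torus_conj_tor g t c d y : torus g t -> c != d -> y \is a GRing.unit ->
  g * tor c d y * g^-1 =
  tor c d (t c * (t d)^-1 * y)%R * (tor c d (t c * (t d)^-1)%R)^-1.
Proof.
move=> gT cd yU.
rewrite tor_div // conjM3 !(torus_conj_weyl gT) ?unitrN1 //.
by rewrite mulrN1.
Qed.

Section Symbols.
(* [R] is a local ring with residue field [F_p] that contains [F_p] and whose
   units congruent to 1 have [p]-power order. *)
Variables (p : nat) (eps : {rmorphism R -> 'F_p}) (iota : {rmorphism 'F_p -> R}).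
Hypotheses (p_prime : prime p) (p_odd : odd p).
Hypothesis eps_unit : forall x, (x \is a GRing.unit) = (eps x != 0%R).
Hypothesis iotaK : cancel iota eps.
Hypothesis eps_unipotent : forall x, eps x = 1%R -> exists N, (x ^+ (p ^ N) = 1)%R.
Hypothesis torsion : forall g, pi g = 1 -> g ^+ p = 1 -> g = 1.

Lemma torsion_pow N g : pi g = 1 -> g ^+ (p ^ N) = 1 -> g = 1.
Proof.
elim: N g => [|N IHN] g pig //.
rewrite expnS expgnA => gN; apply: torsion => //; apply: IHN => //.
by rewrite gmulfXn pig expg1n.
Qed.

(** The Steinberg symbol.  It measures how far [tor a d] is from being
multiplicative ([symbolE]); its values are central and lie over 1
([symbol_kernel]). *)
Definition symbol a b d x y := cm (tor a b x) (tor a d y).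

Section Triple.
Variables a b d : 'I_m.
Hypotheses (ab : a != b) (ad : a != d) (bd : b != d).
Local Notation S := (symbol a b d).

Lemma symbolE x y : x \is a GRing.unit -> y \is a GRing.unit ->
  S x y = tor a d (x * y)%R * (tor a d x)^-1 * (tor a d y)^-1.
Proof.
move=> xU yU; rewrite /symbol /cm (torus_conj_tor (tor_torus ab xU)) //.
by rewrite /tor_weight eqxx eq_sym (negPf ad) eq_sym (negPf bd) divr1.
Qed.

Lemma symbol_kernel x y : x \is a GRing.unit -> y \is a GRing.unit ->
  central (S x y) /\ pi (S x y) = 1.
Proof. by move=> xU yU; apply: torus_cm; apply: tor_torus. Qed.
End Triple.

Section Bilinear.
Variables a b d : 'I_m.
Hypotheses (ab : a != b) (ad : a != d) (bd : b != d).
Local Notation S := (symbol a b d).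

Lemma torM c e f x y : c != e -> c != f -> e != f ->
    x \is a GRing.unit -> y \is a GRing.unit ->
  tor c f (x * y)%R = symbol c e f x y * (tor c f y * tor c f x).
Proof. by move=> *; rewrite symbolE // mulgA !mulgVK. Qed.

(** Symbols are central, so the failure of [tor] to be multiplicative does not
show in a commutator, and commutators are multiplicative in each argument when
their values are central. *)
Lemma symbolMl x x' y : x \is a GRing.unit -> x' \is a GRing.unit ->
  y \is a GRing.unit -> S (x * x')%R y = S x y * S x' y.
Proof.
move=> xU x'U yU; have db : d != b by ne.
have [zC _] := symbol_kernel ad ab xU x'U.
rewrite {1}/symbol (torM ad ab db xU x'U).
have zh e z : a != e -> commute (symbol a d b x x') (tor a e z).
  exact: central_tor.
have -> : cm (symbol a d b x x' * (tor a b x' * tor a b x)) (tor a d y) =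
  cm (tor a b x' * tor a b x) (tor a d y).
  rewrite cm_commuteMl; last exact: zh.
  by apply/commute_conjE/commute_cm; [apply: commuteM|]; apply: zh.
have [sC _] := symbol_kernel ab ad xU yU.
have -> (g h k : G) : cm (g * h) k = g * cm h k * g^-1 * cm g k.
  by rewrite /cm !gnorm.
rewrite -!/(symbol _ _ _ _ _); congr (_ * _).
by apply/commute_conjE/commute_sym/central_tor.
Qed.

Lemma symbolMr x y y' : x \is a GRing.unit -> y \is a GRing.unit ->
  y' \is a GRing.unit -> S x (y * y')%R = S x y * S x y'.
Proof.
move=> xU yU y'U.
have [zC _] := symbol_kernel ab ad yU y'U.
rewrite {1}/symbol (torM ab ad bd yU y'U).
have zh e z : a != e -> commute (symbol a b d y y') (tor a e z).
  exact: central_tor.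
have -> (g h k : G) : cm g (h * k) = cm g h * (h * cm g k * h^-1).
  by rewrite /cm !gnorm.
have cmz g : commute (symbol a b d y y') g -> cm g (symbol a b d y y') = 1.
  by move=> zg; apply/cm_eq1/commute_sym.
rewrite cmz; last exact: zh.
rewrite mul1g.
have [sC _] := symbol_kernel ab ad xU yU.
have [s'C _] := symbol_kernel ab ad xU y'U.
rewrite (commute_conjE _ _).1; last first.
  by apply: commute_cm; [apply: zh | apply: commuteM; apply: zh].
have -> (g h k : G) : cm g (h * k) = cm g h * (h * cm g k * h^-1).
  by rewrite /cm !gnorm.
have c1 : commute (S x y') (S x y) by apply: commute_cm; apply: central_tor.
have c2 : commute (tor a d y') (S x y) by apply/commute_sym/central_tor.
by rewrite -!/(symbol _ _ _ _ _) ((commute_conjE _ _).1 c2).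
Qed.

Lemma symbol1l y : S 1%R y = 1.
Proof. by rewrite /symbol tor1 // cm1g. Qed.

Lemma symbol1r x : S x 1%R = 1.
Proof. by rewrite /symbol tor1 // /cm !gnorm. Qed.

Lemma symbolXl n x y : x \is a GRing.unit -> y \is a GRing.unit ->
  S (x ^+ n)%R y = S x y ^+ n.
Proof.
move=> xU yU; elim: n => [|n IHn]; first by rewrite symbol1l.
by rewrite exprS symbolMl ?unitrX // IHn expgS.
Qed.

Lemma symbolXr n x y : x \is a GRing.unit -> y \is a GRing.unit ->
  S x (y ^+ n)%R = S x y ^+ n.
Proof.
move=> xU yU; elim: n => [|n IHn]; first by rewrite symbol1r.
by rewrite exprS symbolMr ?unitrX // IHn expgS.
Qed.

(** By bilinearity the symbol has the [p]-power order of its argument. *)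
Lemma symbol_unipl x y : eps x = 1%R -> y \is a GRing.unit -> S x y = 1.
Proof.
move=> x1 yU; have xU : x \is a GRing.unit by rewrite eps_unit x1 oner_neq0.
have [N xN] := eps_unipotent x1; have [_ Sk] := symbol_kernel ab ad xU yU.
by apply: (torsion_pow (N := N)) => //; rewrite -symbolXl // xN symbol1l.
Qed.

Lemma symbol_unipr x y : x \is a GRing.unit -> eps y = 1%R -> S x y = 1.
Proof.
move=> xU y1; have yU : y \is a GRing.unit by rewrite eps_unit y1 oner_neq0.
have [N yN] := eps_unipotent y1; have [_ Sk] := symbol_kernel ab ad xU yU.
by apply: (torsion_pow (N := N)) => //; rewrite -symbolXr // yN symbol1r.
Qed.

(** [tor a d x] acts on the root [(a, d)] by [x ^+ 2]; that it commutes with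
itself says that the symbol of [x ^+ 2] and [x] is trivial. *)
Lemma symbol_sqr_diag x : x \is a GRing.unit -> S x x ^+ 2 = 1.
Proof.
move=> xU; rewrite -symbolXl // symbolE ?unitrX //.
have := torus_conj_tor (tor_torus ad xU) ad xU.
rewrite /tor_weight !eqxx eq_sym (negPf ad) invrK mulgK -expr2 => <-.
by rewrite mulgV.
Qed.

(** The two Gauss decompositions of [u a d 1 * u d a (- x)] have the same
diagonal factor, which gives the claim for [x^-1] and [y^-1]. *)
Lemma symbol_steinberg x y : x \is a GRing.unit -> y \is a GRing.unit ->
  (x + y = 1)%R -> S x y = 1.
Proof.
move=> xU yU xy1.
have VU z : z \is a GRing.unit -> z^-1%R \is a GRing.unit by rewrite unitrV.
have E : S x^-1%R y^-1%R = 1.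
  rewrite symbolE ?VU //.
  have NxU : (- x)%R \is a GRing.unit by rewrite unitrN.
  have yE : y = (1 + 1 * - x)%R by rewrite mul1r -xy1; ring.
  have := gauss_unitr ad NxU yU yE.
  rewrite (gauss_unitl ad (unitr1 _) yU yE) => /mulIg/mulgI.
  rewrite mul1r invrN opprK mulNr -!tor_div // tor1 // mul1g => ->.
  by rewrite mulgA mulgVK mulgV.
have S1 : S x^-1%R y = 1.
  have := symbolMr (VU _ xU) yU (VU _ yU).
  by rewrite E mulrV // symbol1r mulg1.
have := symbolMl xU (VU _ xU) yU.
by rewrite S1 mulrV // symbol1l mulg1.
Qed.

(** The odd powers of a generator [g] of the units of [F_p] form the coset of [g]
modulo squares.  There are as many of them as nonzero squares, so
[v |-> 1 - v] cannot send all of them to squares different from 1: two of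
them add up to 1, unless 1 is one of them.  In both cases an odd power of the
symbol of [g] with itself is trivial, and so is its square. *)
Lemma symbol_generator (g : 'F_p) : g != 0%R ->
  (forall c : 'F_p, c != 0%R -> exists k, c = (g ^+ k)%R) ->
  S (iota g) (iota g) = 1.
Proof.
move=> g0 gen; have gU : iota g \is a GRing.unit by rewrite eps_unit iotaK.
have odd1 n : odd n -> S (iota g) (iota g) ^+ n = 1 -> S (iota g) (iota g) = 1.
  move=> n_odd; rewrite -(odd_double_half n) n_odd expgnDr expg1 -mul2n expgnA.
  by rewrite symbol_sqr_diag // expg1n mulg1.
pose Q := [set (z ^+ 2)%R | z in [pred z : 'F_p | z != 0%R]].
pose O := [set (g * z)%R | z in Q].
have OP (v : 'F_p) : v \in O -> exists k, v = (g ^+ k.*2.+1)%R.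
  case/imsetP => _ /imsetP[z /gen[k ->] ->] ->.
  by exists k; rewrite -exprM muln2 -exprS.
have cardO : #|O| = #|Q| by apply: card_imset; apply: mulfI.
have [/OP[k gk]|n1O] := boolP (1%R \in O).
  apply: (odd1 k.*2.+1); first by rewrite /= odd_double.
  by rewrite -symbolXl // -rmorphXn -gk rmorph1 symbol1l.
have [/existsP[v /andP[vO v1O]]|nex] :=
    boolP [exists v : 'F_p, (v \in O) && ((1 - v)%R \in O)].
  have [i iE] := OP _ vO; have [j jE] := OP _ v1O.
  apply: (odd1 (i.*2.+1 * j.*2.+1)%N); first by rewrite oddM /= !odd_double.
  rewrite expgnA -symbolXl // -symbolXr ?unitrX // -!rmorphXn /= -iE -jE.
  apply: symbol_steinberg; last by rewrite -rmorphD addrC subrK rmorph1.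
    by rewrite iE rmorphXn unitrX.
  by rewrite jE rmorphXn unitrX.
have : #|[set (1 - v)%R | v : 'F_p in O]| <= #|Q :\ 1%R|.
  apply/subset_leq_card/fintype.subsetP => _ /imsetP[v vO ->].
  have v0 : v != 0%R by have [k ->] := OP _ vO; rewrite expf_neq0.
  rewrite !inE -subr_eq0 addrAC subrr add0r oppr_eq0 v0 /=.
  have v1 : (1 - v)%R != 0%R by rewrite subr_eq0; apply: contraNneq n1O => ->.
  have n1v : (1 - v)%R \notin O.
    by apply: contra nex => v1O; apply/existsP; exists v; rewrite vO.
  have [k kE] := gen _ v1; rewrite kE in n1v *.
  have gQ j : (g ^+ j.*2)%R \in Q.
    by apply/imsetP; exists (g ^+ j)%R; rewrite ?inE ?expf_neq0 // -exprM muln2.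
  move: n1v; rewrite -(odd_double_half k); case: odd; last by rewrite add0n.
  by case/negP; rewrite add1n exprS; apply/imsetP; exists (g ^+ k./2.*2)%R.
rewrite card_imset; last by move=> v w /addrI/oppr_inj.
rewrite cardO (cardsD1 1%R Q) (_ : 1%R \in Q) ?add1n ?ltnn //.
by apply/imsetP; exists 1%R; rewrite ?inE ?oner_neq0 // expr1n.
Qed.

(** Every unit is a power of a lifted generator of the units of [F_p] times a
unit congruent to 1. *)
Lemma symbol_trivial x y : x \is a GRing.unit -> y \is a GRing.unit ->
  S x y = 1.
Proof.
have gen : exists2 g : 'F_p, g != 0%R &
    forall c : 'F_p, c != 0%R -> exists k, c = (g ^+ k)%R.
  have /cyclicP[g gE] := field_unit_group_cyclic [set: {unit 'F_p}]%G.
  exists (val g); first by rewrite -unitfE; apply: (valP g).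
  move=> c c0; have cU : c \is a GRing.unit by rewrite unitfE.
  have : FinRing.unit _ cU \in [set: {unit 'F_p}]%G by rewrite inE.
  rewrite gE => /cycleP[k /(congr1 val)]; rewrite FinRing.val_unitX /= => ->.
  by exists k.
have [g g0 gP] := gen.
have split z : z \is a GRing.unit -> exists k r,
    [/\ z = (iota g ^+ k * r)%R, eps r = 1%R & r \is a GRing.unit].
  rewrite eps_unit => /[dup] z0 /gP[k kE].
  have gkU : (iota g ^+ k)%R \is a GRing.unit by rewrite unitrX // eps_unit iotaK.
  have e1 : eps ((iota g ^+ k)^-1 * z)%R = 1%R.
    rewrite rmorphM rmorphV //= rmorphXn /= iotaK -kE mulVf //.
  exists k, ((iota g ^+ k)^-1 * z)%R.
  by rewrite mulVKr // eps_unit e1 oner_neq0.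
move=> /split[i [r [-> r1 rU]]] /split[j [t [-> t1 tU]]].
have gU : iota g \is a GRing.unit by rewrite eps_unit iotaK.
have gX k : (iota g ^+ k)%R \is a GRing.unit by rewrite unitrX.
rewrite (symbolMl (gX i) rU); last by rewrite unitrM gX.
rewrite [S r _](symbol_unipl r1) ?unitrM ?gX // mulg1.
rewrite (symbolMr (gX i) (gX j) tU) [S _ t](symbol_unipr _ t1) // mulg1.
by rewrite symbolXl // symbolXr // symbol_generator // !expg1n.
Qed.

End Bilinear.

(** ** The torus *)

Lemma tor_morph c d x y : c != d -> x \is a GRing.unit -> y \is a GRing.unit ->
  tor c d (x * y)%R = tor c d y * tor c d x.
Proof.
move=> cd xU yU; have [e /andP[ec ed]] := third c d.
rewrite (@torM c e d) //; try ne.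
by rewrite symbol_trivial ?mul1g //; ne.
Qed.

Lemma torus_commute_tor g t c d y : torus g t -> c != d ->
  y \is a GRing.unit -> commute g (tor c d y).
Proof.
move=> gT cd yU; apply/commute_conjE; rewrite (torus_conj_tor gT) //.
have tU := torus_unit gT.
have xU : (t c * (t d)^-1)%R \is a GRing.unit by rewrite unitrM unitrV !tU.
by rewrite tor_morph // mulgK.
Qed.

Definition torus_word k := word (fun g => exists (a b : 'I_m) x,
  [/\ b = a.+1 :> nat, b <= k, x \is a GRing.unit & g = tor a b x]).

Let adj_neq a b : b = a.+1 :> nat -> a != b.
Proof. by move=> E; rewrite -val_eqE /= E; lia. Qed.

Lemma torus_word_torus k g : torus_word k g ->
  exists2 t, torus g t & forall c, k < c -> t c = 1%R.
Proof.
elim=> [|_ h [a [b [x [ba bk xU ->]]]] _ [t hT t1]].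
  by exists (fun=> 1%R) => //; apply: torus1.
exists (fun c => tor_weight a b x c * t c)%R.
  by apply: torusM => //; apply: tor_torus => //; apply: adj_neq.
move=> c kc; rewrite t1 // mulr1 /tor_weight.
by do 2?[case: eqP => [E|_]]; rewrite // ?E in kc *; lia.
Qed.

Lemma torus_word_last k g (a b : 'I_m) : a = k :> nat -> b = k.+1 :> nat ->
  torus_word k.+1 g -> exists x h,
  [/\ x \is a GRing.unit, torus_word k h & g = tor a b x * h].
Proof.
move=> ak bk; have ab : a != b by apply: adj_neq; rewrite bk ak.
elim=> [|_ h [a' [b' [y [ba' b'k yU ->]]]] _ [x [h' [xU wh ->]]]].
  by exists 1%R, 1; rewrite tor1 // mulg1 unitr1; split=> //; apply: word1.
have ab' := adj_neq ba'.
have [b'E|b'k'] := eqVneq (b' : nat) k.+1.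
  have [<- <-] : a' = a /\ b' = b by split; apply: val_inj; rewrite /=; lia.
  exists (x * y)%R, h'; split=> //; first by rewrite unitrM xU.
  by rewrite mulgA tor_morph.
exists x, (tor a' b' y * h'); split=> //.
  apply: wordM => //; exists a', b', y; split=> //.
  by rewrite leq_eqVlt (negPf b'k') in b'k.
by rewrite mulgA (torus_commute_tor (tor_torus ab' yU) ab xU) -mulgA.
Qed.

(** The matrix determines the parameters one after the other, from the last
diagonal entry upwards. *)
Lemma torus_word_inj k g : torus_word k g -> pi g = 1 -> g = 1.
Proof.
elim: k g => [|k IHk] g.
  by case=> // s h [a [b [x [-> ]]]].
have [mk|km] := leqP m k.+1.
  move=> wg; apply: IHk; apply: word_sub wg => _ [a [b [x [ba bk xU ->]]]].
  by apply: word_gen; exists a, b, x; split=> //; have := ltn_ord b; lia.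
move=> /(@torus_word_last k g (Ordinal (ltnW km)) (Ordinal km) erefl erefl).
set a := Ordinal _; set b := Ordinal _ => -[x [h [xU wh ->]]] pi1.
have ab : a != b by apply: adj_neq.
have [t hT t1] := torus_word_torus wh.
have := torus_mx (torusM (tor_torus ab xU) hT) 1%:M%R b b.
rewrite pi1 mulmx1 /= !mxE eqxx t1 // /tor_weight eqxx eq_sym (negPf ab).
rewrite !mulr1 => xV.
have x1 : x = 1%R by rewrite -[x]invrK -xV invr1.
by move: pi1; rewrite x1 tor1 // mul1g => /(IHk _ wh).
Qed.

(** ** Unipotent subgroups *)

Section Unipotent.
(* A height function on the indices treats upper and lower triangular matrices
   alike. *)
Variable rho : 'I_m -> nat.
Hypothesis rho_inj : injective rho.

Definition unip_word k := word (fun g => exists a b r,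
  [/\ rho a < rho b, rho b < k & g = u a b r]).

Let rho_neq a b : rho a < rho b -> a != b.
Proof. by apply: contraTneq => ->; rewrite ltnn. Qed.

Definition col_word c := word (fun g => exists a r, rho a < rho c /\ g = u a c r).

Lemma col_word_exp c g : (forall a b r, a != b -> u a b r ^+ p = 1) ->
  col_word c g -> g ^+ p = 1.
Proof.
move=> uE; elim=> [|_ h [a [r [ac ->]]] wh IH]; first by rewrite expg1n.
rewrite expgMn ?uE ?IH ?mulg1 //; first exact: rho_neq.
apply: word_commute wh => _ [a' [r' [ac' ->]]].
by apply: uC; first [exact: rho_neq | by rewrite eq_sym rho_neq].
Qed.

Lemma col_word_conj k c g h : rho c = k -> unip_word k h -> col_word c g ->
  col_word c (h * g * h^-1).
Proof.
move=> ck; elim=> [|_ h' [a [b [r [ab bk ->]]]] _ IH wg].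
  by rewrite mul1g invg1 mulg1.
have -> : u a b r * h' * g * (u a b r * h')^-1 =
    u a b r * (h' * g * h'^-1) * (u a b r)^-1 by rewrite !gnorm.
apply: word_conj (IH wg) => _ [a' [r' [a'c ->]]].
have [ba'|ba'] := eqVneq b a'.
  subst a'; rewrite root_conjl ?rho_neq //; last exact: ltn_trans a'c.
  apply: wordM; last by apply: word_gen; exists b, r'.
  by exists a, (r * r')%R; split=> //; apply: ltn_trans a'c.
rewrite root_conj_fix //; try by apply: rho_neq; lia.
by apply: word_gen; exists a', r'.
Qed.

Lemma unip_word_split k c g : rho c = k -> unip_word k.+1 g ->
  exists g1 g2 : G, [/\ col_word c g1, unip_word k g2 & g = g1 * g2].
Proof.
move=> ck; elim=> [|_ h [a [b [r [ab bk ->]]]] _ [x [y [wx wy ->]]]].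
  by exists 1, 1; rewrite mulg1; split=> //; apply: word1.
have [bE|bk'] := eqVneq (rho b) k.
  have bc : b = c by apply: rho_inj; rewrite bE.
  subst b; exists (u a c r * x), y; rewrite mulgA; split=> //.
  by apply: wordM => //; exists a, r.
have wab : unip_word k (u a b r).
  by apply: word_gen; exists a, b, r; split=> //; lia.
exists (u a b r * x * (u a b r)^-1), (u a b r * y).
split; [exact: (col_word_conj ck wab wx) | exact: wordMM | by rewrite !mulgA mulgVK].
Qed.

(** The column of highest index is an abelian normal subgroup of exponent [p];
the power of [g] that is trivial in the quotient lies in it. *)
Lemma unip_word_exp k g : (forall a b r, a != b -> u a b r ^+ p = 1) ->
  unip_word k g -> exists N, g ^+ (p ^ N) = 1.
Proof.
move=> uE; elim: k g => [|k IHk] g.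
  by case=> [|_ h [a [b [r [_ //]]]]]; exists 0.
have [/existsP[c /eqP ck]|nk] := boolP [exists c, rho c == k]; last first.
  move=> wg; apply: IHk; apply: word_sub wg => _ [a [b [r [ab bk ->]]]].
  apply: word_gen; exists a, b, r; split=> //.
  move: bk; rewrite ltnS leq_eqVlt => /orP[bk|//].
  by case/negP: nk; apply/existsP; exists b.
move=> /(unip_word_split ck)[x [y [wx wy ->]]]; have [N yN] := IHk _ wy.
have xy n : exists2 z, col_word c z & (x * y) ^+ n = z * y ^+ n.
  elim: n => [|n [z wz IHn]].
    by exists 1; rewrite ?mul1g //; apply: word1.
  exists (x * (y * z * y^-1)); first by apply: wordMM => //; apply: (col_word_conj ck wy).
  by rewrite !expgS IHn !mulgA mulgVK.
have [z wz xyN] := xy (p ^ N)%N; exists N.+1.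
by rewrite expnSr expgnA xyN yN mulg1 (col_word_exp uE wz).
Qed.

End Unipotent.

Lemma root_exp a b r : a != b -> u a b r ^+ p = 1.
Proof.
move=> ab; have rX n : u a b r ^+ n = u a b (r *+ n)%R.
  by elim: n => [|n IHn]; rewrite ?mulr0n ?root0 // expgS IHn mulrS uD.
have p0 : (p%:R = 0 :> R)%R.
  by rewrite -(rmorph_nat iota) pchar_Fp_0 // rmorph0.
by rewrite rX -mulr_natr p0 mulr0 root0.
Qed.

(** ** Gauss decomposition *)

Definition rel_word (lt : rel 'I_m) :=
  word (fun g => exists a b r, lt a b /\ g = u a b r).

Section SimpleRoot.
(* [lt_next] and [lt_prev] say that [b] comes just after [a], so that [(a, b)]
   is a simple root. *)
Variables (lt : rel 'I_m) (a b : 'I_m).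
Hypotheses (lt_irr : irreflexive lt) (lt_tr : transitive lt) (lt_ab : lt a b).
Hypothesis lt_next : forall c, lt a c -> c != b -> lt b c.
Hypothesis lt_prev : forall c, lt c b -> c != a -> lt c a.

Let lt_neq c d : lt c d -> c != d.
Proof. by apply: contraTneq => ->; rewrite lt_irr. Qed.

(** The unipotent radical of the minimal parabolic subgroup of the simple root
[(a, b)]: all positive roots but this one.  It is normalised by the root
subgroups of [(a, b)] and of [(b, a)]. *)
Definition radical_word := word (fun g => exists c d r,
  [/\ lt c d, (c != a) || (d != b) & g = u c d r]).

Let radical_gen c d r : lt c d -> (c != a) || (d != b) ->
  radical_word (u c d r).
Proof. by move=> cd ne; apply: word_gen; exists c, d, r. Qed.

Lemma radical_conj r g : radical_word g ->
  radical_word (u a b r * g * (u a b r)^-1).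
Proof.
apply: word_conj => _ [c [d [r' [cd cdab ->]]]].
have [bc|bc] := eqVneq b c.
  subst c; rewrite root_conjl ?lt_neq //; last exact: lt_tr cd.
  apply: wordMM; apply: radical_gen => //; first exact: lt_tr cd.
  by rewrite orbC eq_sym lt_neq.
have [da|da] := eqVneq d a.
  subst d; rewrite root_conjr ?lt_neq //; last exact: lt_tr lt_ab.
  apply: wordMM; apply: radical_gen => //; first exact: lt_tr lt_ab.
  by rewrite lt_neq.
rewrite root_conj_fix //; first exact: radical_gen.
- exact: lt_neq.
- exact: lt_neq.
- by rewrite eq_sym.
Qed.

Lemma radical_conj_opp r g : radical_word g ->
  radical_word (u b a r * g * (u b a r)^-1).
Proof.
have ba : b != a by rewrite eq_sym lt_neq.
apply: word_conj => _ [c [d [r' [cd cdab ->]]]].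
have [ac|ac] := eqVneq a c.
  subst c; rewrite eqxx /= in cdab.
  have bd := lt_next cd cdab.
  rewrite root_conjl // ?lt_neq //.
  by apply: wordMM; apply: radical_gen => //; rewrite ?ba // cdab orbT.
have [db|db] := eqVneq d b.
  subst d; rewrite eqxx /= orbF in cdab.
  have ca := lt_prev cd cdab.
  rewrite root_conjr // ?lt_neq //.
  by apply: wordMM; apply: radical_gen => //; rewrite ?cdab // eq_sym ba orbT.
rewrite root_conj_fix //; first exact: radical_gen.
- exact: lt_neq.
- by rewrite eq_sym.
Qed.

Lemma radical_split g : rel_word lt g ->
  exists r h, radical_word h /\ g = u a b r * h.
Proof.
have ab := lt_neq lt_ab.
elim=> [|_ g' [c [d [r' [cd ->]]]] _ [r [h [wh ->]]]].
  by exists 0%R, 1; rewrite root0 // mulg1; split=> //; apply: word1.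
have [/andP[/eqP ca /eqP db]|cdab] := boolP ((c == a) && (d == b)).
  by subst c d; exists (r' + r)%R, h; rewrite uD // mulgA.
rewrite negb_and in cdab.
exists r, (u a b (- r)%R * u c d r' * (u a b (- r)%R)^-1 * h); split.
  by apply: wordMM wh; apply: radical_conj; apply: radical_gen.
by rewrite rootN // !gnorm.
Qed.

Lemma radical_rel g : radical_word g -> rel_word lt g.
Proof.
by apply: word_sub => _ [c [d [r [cd _ ->]]]]; apply: word_gen; exists c, d, r.
Qed.

End SimpleRoot.

Lemma torV a b x : a != b -> x \is a GRing.unit ->
  (tor a b x)^-1 = tor a b x^-1%R.
Proof.
move=> ab xU; apply: mulg1_eq; rewrite -tor_morph ?unitrV //.
by rewrite mulVr // tor1.
Qed.

Definition torus_elt := torus_word m.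

Lemma torus_elt_tor (a b : 'I_m) x : b = a.+1 :> nat -> x \is a GRing.unit ->
  torus_elt (tor a b x).
Proof. by move=> ba xU; apply: word_gen; exists a, b, x; split=> //; apply: ltnW. Qed.

Lemma torus_eltV g : torus_elt g -> torus_elt g^-1.
Proof.
apply: wordV => _ [a [b [x [ba bm xU ->]]]].
exists a, b, x^-1%R; split=> //; first by rewrite unitrV.
by rewrite torV // adj_neq.
Qed.

Lemma torus_elt_torus g : torus_elt g -> exists t, torus g t.
Proof. by case/torus_word_torus => t gT _; exists t. Qed.

Lemma torus_elt_rel lt g h : irreflexive lt -> torus_elt g -> rel_word lt h ->
  rel_word lt (g * h * g^-1).
Proof.
move=> lt_irr /torus_elt_torus[t gT]; apply: word_conj => _ [a [b [r [ab ->]]]].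
rewrite (torus_conj gT); last by apply: contraTneq ab => ->; rewrite lt_irr.
by apply: word_gen; exists a, b; eexists.
Qed.

Lemma two_neq0 : (1 + 1 : 'F_p)%R != 0%R.
Proof.
apply/negP; rewrite -(natrD _ 1 1) -(dvdn_pcharf (pchar_Fp p_prime)).
move/(dvdn_leq (isT : 0 < 2)); move: p_odd (prime_gt1 p_prime).
by case: (p) => [|[|[|]]].
Qed.

Section RankOne.
Variables a b : 'I_m.
Hypothesis ba : b = a.+1 :> nat.

Let ab : a != b. Proof. exact: adj_neq. Qed.
Let ba' : b != a. Proof. by rewrite eq_sym. Qed.

(** If [x] is not a unit, it is the sum of the units [l] and [x - l] for [l = 1]
and for [l = -1].  One of the two choices makes the intermediate diagonal entry
[1 + (x - l) * y] a unit, because 2 is not 0 in [F_p]. *)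
Lemma gauss_commute x y : (1 + x * y)%R \is a GRing.unit -> exists y' h x',
  torus_elt h /\ u a b x * u b a y = u b a y' * h * u a b x'.
Proof.
have unitl z w : z \is a GRing.unit -> (1 + z * w)%R \is a GRing.unit ->
    exists h, torus_elt h /\ u a b z * u b a w =
      u b a (w * (1 + z * w)^-1)%R * h * u a b (z * (1 + z * w)^-1)%R.
  move=> zU vU; rewrite (gauss_unitl ab zU vU erefl) -tor_div //.
  eexists; split; last by [].
  have zvU : (z * (1 + z * w)^-1)%R \is a GRing.unit.
    by rewrite unitrM zU unitrV.
  by apply: wordMM; rewrite ?torV //; apply: torus_elt_tor; rewrite ?unitrV.
move=> vU; have [xU|xNU] := boolP (x \is a GRing.unit).
  by have [h [hT ->]] := unitl _ _ xU vU; do 3!eexists; split; [exact: hT|].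
have x0 : eps x = 0%R by move: xNU; rewrite eps_unit negbK => /eqP.
pose l : R := if eps y == 1%R then (-1)%R else 1%R.
have lU : l \is a GRing.unit by rewrite /l; case: ifP; rewrite ?unitrN1 ?unitr1.
have xlU : (x - l)%R \is a GRing.unit.
  by rewrite eps_unit rmorphB x0 sub0r oppr_eq0 -eps_unit.
have v1U : (1 + (x - l) * y)%R \is a GRing.unit.
  rewrite eps_unit rmorphD rmorphM rmorphB x0 sub0r rmorph1 /l.
  case: (eqVneq (eps y) 1%R) => [->|y1].
    by rewrite rmorphN1 opprK mulr1 two_neq0.
  by rewrite rmorph1 mulN1r subr_eq0 eq_sym.
have [h1 [h1T E1]] := unitl _ _ xlU v1U.
have v2U : (1 + l * (y * (1 + (x - l) * y)^-1))%R \is a GRing.unit.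
  have -> : (1 + l * (y * (1 + (x - l) * y)^-1) =
    (1 + x * y) * (1 + (x - l) * y)^-1)%R.
    have vV := mulrV v1U; move: (_^-1)%R vV => w vV.
    by rewrite -{1}vV; ring.
  by rewrite unitrM vU unitrV.
have [h2 [h2T E2]] := unitl _ _ lU v2U.
have [t h1t] := torus_elt_torus h1T.
have -> : x = (l + (x - l))%R by rewrite addrC subrK.
rewrite uD // -mulgA E1 !mulgA E2 -!mulgA.
set z := (l * (1 + _)^-1)%R; rewrite [u a b z * _]mulgA.
have -> : u a b z * h1 = h1 * (h1^-1 * u a b z * h1^-1^-1).
  by rewrite !gnorm.
rewrite (torus_conj (torusV h1t)) // -mulgA -uD //.
exists (y * (1 + (x - l) * y)^-1 * (1 + l * (y * (1 + (x - l) * y)^-1))^-1)%R.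
exists (h2 * h1); eexists; split; first exact: wordMM.
by rewrite !mulgA.
Qed.

(** The rank one case of the stability of Gauss decompositions under lower root
elements.  If [1 + x * y] is not a unit, then [y] is one, and a factor
[u a b z] split off on the left replaces [x] by [z' + x] with [z'] a unit. *)
Lemma gauss_reduce r x y : exists z y' h x', torus_elt h /\
  u b a r * u a b x * u b a y = u a b z * u b a y' * h * u a b x'.
Proof.
have [vU|vNU] := boolP ((1 + x * y)%R \is a GRing.unit).
  have [y' [h [x' [hT E]]]] := gauss_commute vU.
  exists 0%R, (r + y')%R, h, x'; split=> //.
  by rewrite -mulgA E root0 // mul1g uD // !mulgA.
have v0 : (1 + eps x * eps y = 0)%R.
  by move: vNU; rewrite eps_unit negbK rmorphD rmorph1 rmorphM => /eqP.
pose z : R := if eps r == 1%R then (-1)%R else 1%R.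
have zU : z \is a GRing.unit by rewrite /z; case: ifP; rewrite ?unitrN1 ?unitr1.
have NzU : (- z)%R \is a GRing.unit by rewrite unitrN.
have wU : (1 + - z * r)%R \is a GRing.unit.
  rewrite eps_unit rmorphD rmorphM rmorph1 rmorphN /z.
  case: (eqVneq (eps r) 1%R) => [->|r1].
    by rewrite rmorphN1 opprK mulr1 two_neq0.
  by rewrite rmorph1 mulN1r subr_eq0 eq_sym.
have E1 := gauss_unitl ab NzU wU erefl; rewrite -tor_div // in E1.
move: E1; set z' := (- z * _^-1)%R; set h1 := (_ * _^-1); set r' := (r * _)%R.
move=> E1.
have h1T : torus_elt h1.
  apply: wordMM; first exact: torus_elt_tor.
  by apply/torus_eltV/torus_elt_tor => //; rewrite unitrM NzU unitrV.
have vU : (1 + (z' + x) * y)%R \is a GRing.unit.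
  have y0 : eps y != 0%R.
    by apply: contra_eq_neq v0 => ->; rewrite mulr0 addr0 oner_neq0.
  have -> : (1 + (z' + x) * y = (1 + x * y) + z' * y)%R by ring.
  rewrite eps_unit rmorphD rmorphD rmorph1 rmorphM v0 add0r rmorphM mulf_neq0 //.
  by rewrite -eps_unit unitrM NzU unitrV.
have [y' [h [x' [hT E]]]] := gauss_commute vU.
have [t h1t] := torus_elt_torus h1T.
clearbody h1; exists z, (r' + t b * y' * (t a)^-1)%R, (h1 * h), x'.
split; first exact: wordMM.
have -> : u b a r = u a b z * (u a b (- z)%R * u b a r).
  by rewrite rootN // mulVKg.
rewrite E1 -!mulgA; congr (_ * _).
rewrite (mulgA (u a b z')) -uD // E.
have F : h1 * u b a y' = u b a (t b * y' * (t a)^-1)%R * h1.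
  by rewrite -(torus_conj h1t) // mulgVK.
by rewrite uD // -!mulgA (mulgA h1) F -!mulgA.
Qed.

End RankOne.

Let ltI : rel 'I_m := fun a b => a < b.
Let gtI : rel 'I_m := fun a b => b < a.
Let ltI_irr : irreflexive ltI. Proof. by move=> a; apply: ltnn. Qed.
Let gtI_irr : irreflexive gtI. Proof. by move=> a; apply: ltnn. Qed.
Let ltI_tr : transitive ltI. Proof. by move=> b a c; apply: ltn_trans. Qed.
Let gtI_tr : transitive gtI.
Proof. by move=> b a c ba cb; apply: ltn_trans cb ba. Qed.

Definition gauss g := exists x1 x2 h x3 : G,
  [/\ rel_word ltI x1, rel_word gtI x2, torus_elt h, rel_word ltI x3 &
      g = x1 * x2 * h * x3].

(** The products of upper, lower, diagonal and upper factors are all of the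
group once they are stable under multiplication by root elements. *)
Definition gauss_stable s := forall g, gauss g -> gauss (s * g).

Lemma gauss_stableM s s' : gauss_stable s -> gauss_stable s' ->
  gauss_stable (s * s').
Proof. by move=> sS s'S g gG; rewrite -mulgA; apply/sS/s'S. Qed.

Lemma gauss_stable_upper s : rel_word ltI s -> gauss_stable s.
Proof.
move=> ws _ [x1 [x2 [h [x3 [w1 w2 wh w3 ->]]]]].
by exists (s * x1), x2, h, x3; rewrite !mulgA; split=> //; apply: wordMM.
Qed.

(** Both unipotent factors split into the simple root and the radical; the
radicals move out of the way, and [gauss_reduce] treats what remains. *)
Lemma gauss_stable_simple (a b : 'I_m) r : b = a.+1 :> nat ->
  gauss_stable (u b a r).
Proof.
move=> ba _ [x1 [x2 [h [x3 [w1 w2 wh w3 ->]]]]].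
have lt_ab : ltI a b by rewrite /ltI ba.
have next c : ltI a c -> c != b -> ltI b c.
  by rewrite /ltI -val_eqE /=; lia.
have prev c : ltI c b -> c != a -> ltI c a.
  by rewrite /ltI -val_eqE /=; lia.
have [c [k1 [wk1 x1E]]] := radical_split ltI_irr ltI_tr lt_ab w1.
have [y [k2 [wk2 x2E]]] := radical_split gtI_irr gtI_tr lt_ab w2.
have [z [y' [k [x' [wk E]]]]] := gauss_reduce ba r c y.
have w1' := radical_conj ltI_irr ltI_tr lt_ab c wk1.
have w1'' := radical_conj_opp ltI_irr lt_ab next prev r w1'.
have w2' := radical_conj_opp gtI_irr lt_ab prev next x' wk2.
have w2'' := torus_elt_rel gtI_irr wk (radical_rel w2').
exists (u b a r * (u a b c * k1 * (u a b c)^-1) * (u b a r)^-1 * u a b z).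
exists (u b a y' * (k * (u a b x' * k2 * (u a b x')^-1) * k^-1)).
exists (k * h), (h^-1 * u a b x' * h^-1^-1 * x3); split.
- apply: wordMM; first exact: radical_rel w1''.
  by apply: word_gen; exists a, b, z.
- by apply: wordMM => //; apply: word_gen; exists b, a, y'.
- exact: wordMM.
- apply: wordMM => //; apply: torus_elt_rel => //; first exact: torus_eltV.
  by apply: word_gen; exists a, b, x'.
have -> : u b a r * (x1 * x2 * h * x3) =
    u b a r * (u a b c * k1 * (u a b c)^-1) * (u b a r)^-1 *
    (u b a r * u a b c * u b a y) * k2 * h * x3.
  by rewrite x1E x2E !gnorm.
by rewrite E !gnorm.
Qed.

(** The lower roots are iterated commutators of simple ones. *)
Lemma gauss_stable_root a b r : a != b -> gauss_stable (u a b r).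
Proof.
rewrite -val_eqE neq_ltn => /orP[ab|].
  by apply: gauss_stable_upper; apply: word_gen; exists a, b, r.
have [n] := ubnP (a - b); elim: n a r => // n IHn a r an /= ba.
have [aS|aS] := eqVneq (a : nat) b.+1; first exact: gauss_stable_simple.
have em : a.-1 < m by have := ltn_ord a; lia.
pose e := Ordinal em.
have ae : a = e.+1 :> nat by rewrite /=; lia.
have be : b < e by rewrite /=; lia.
have E : u a b r = u a e r * (u e b 1%R * (u a e (- r)%R * u e b (-1)%R)).
  have ae' : a != e by rewrite -val_eqE /=; lia.
  have eb' : e != b by rewrite -val_eqE /=; lia.
  have ab' : a != b by rewrite -val_eqE /=; lia.
  by rewrite !rootN // -[in LHS](mulr1 r) -(uM _ _ ae' eb' ab') /cm !mulgA.
rewrite E; do 3?[apply: gauss_stableM].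
- exact: gauss_stable_simple.
- by apply: IHn; rewrite //= ; lia.
- exact: gauss_stable_simple.
- by apply: IHn; rewrite //= ; lia.
Qed.

Definition root_word := word (fun g => exists a b r, a != b /\ g = u a b r).

Lemma root_word_gauss g : root_word g -> gauss g.
Proof.
elim=> [|_ h [a [b [r [ab ->]]]] _ IH]; last exact: gauss_stable_root.
by exists 1, 1, 1, 1; rewrite !mulg1; split=> //; apply: word1.
Qed.

Lemma rel_word_mx (lt : rel 'I_m) g : irreflexive lt -> transitive lt ->
    rel_word lt g -> (forall a, SL_mx (pi g) a a = 1%R) /\
  forall a b, a != b -> ~~ lt a b -> SL_mx (pi g) a b = 0%R.
Proof.
move=> irr tr; elim=> [|_ h [a [b [r [ab ->]]]] _ [IH1 IH0]].
  rewrite gmulf1 /=; split=> [a|a b ab _]; rewrite !mxE ?eqxx //.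
  by rewrite (negPf ab).
have anb : a != b by apply: contraTneq ab => ->; rewrite irr.
have nba : ~~ lt b a by apply/negP => /(tr _ _ _ ab); rewrite irr.
have E c d : SL_mx (pi (u a b r * h)) c d =
    (SL_mx (pi h) c d + (c == a)%:R * (r * SL_mx (pi h) b d))%R.
  by rewrite gmulfM /= (st_pi st) // elem_mulmx.
split=> [c|c d cd ncd]; rewrite E; case: eqP => [ca|_].
- by subst c; rewrite IH1 [SL_mx _ b a]IH0 ?mulr0 ?addr0 //; ne.
- by rewrite IH1 mul0r addr0.
- subst c; rewrite IH0 // [SL_mx _ b d]IH0 ?mulr0 ?addr0 //.
    by apply: contraNneq ncd => <-.
  by apply: contra ncd => /(tr _ _ _ ab).
- by rewrite IH0 // mul0r addr0.
Qed.

Lemma rel_word_inj (lt : rel 'I_m) (rho : 'I_m -> nat) g : injective rho ->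
    (forall a b, lt a b -> rho a < rho b) -> (forall a, rho a <= m) ->
  rel_word lt g -> pi g = 1 -> g = 1.
Proof.
move=> rho_inj lt_rho rho_m wg pig.
have wg' : unip_word rho m.+1 g.
  apply: word_sub wg => _ [a [b [r [ab ->]]]]; apply: word_gen.
  by exists a, b, r; split=> //; [apply: lt_rho|rewrite ltnS].
have [N gN] := unip_word_exp rho_inj root_exp wg'.
exact: torsion_pow gN.
Qed.

(** If the product of the Gauss factors lies over 1, then the lower and diagonal
factors together lie over an upper unipotent matrix, so that each factor lies
over 1 by itself. *)
Lemma steinberg_injective g : root_word g -> pi g = 1 -> g = 1.
Proof.
move=> /root_word_gauss[x1 [x2 [h [x3 [w1 w2 wh w3 ->]]]]] pi1.
pose x2' := h^-1 * x2 * h^-1^-1; pose y := x1^-1 * x3^-1.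
have w2' : rel_word gtI x2' by apply: torus_elt_rel (torus_eltV wh) w2.
have ltV s : (exists a b r, ltI a b /\ s = u a b r) ->
    exists a b r, ltI a b /\ s^-1 = u a b r.
  move=> [a [b [r [ab ->]]]]; exists a, b, (- r)%R; split=> //.
  by rewrite rootN //; apply: contraTneq ab => ->; rewrite ltI_irr.
have wy : rel_word ltI y by apply: wordMM; apply: wordV.
have E : pi (h * x2') = pi y.
  have -> : h * x2' = x1^-1 * (x1 * x2 * h * x3) * x3^-1 by rewrite !gnorm.
  by rewrite gmulfM [pi (_^-1 * _)]gmulfM pi1 mulg1 -gmulfM.
have [t hT] := torus_elt_torus wh; have tU := torus_unit hT.
have [Y1 Y0] := rel_word_mx ltI_irr ltI_tr wy.
have [X1 X0] := rel_word_mx gtI_irr gtI_tr w2'.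
have M a b : (t a * SL_mx (pi x2') a b)%R = SL_mx (pi y) a b.
  by rewrite -(torus_mx hT) -E [pi (h * x2')]gmulfM.
have t1 a : t a = 1%R by have := M a a; rewrite X1 Y1 mulr1.
have [_ pih] := torus_kernel hT t1.
have pix : pi x2' = 1.
  apply: val_inj; apply/matrixP => a b; rewrite /= !mxE.
  case: (eqVneq a b) => [->|ab]; first by rewrite X1.
  have [lab|nab] := boolP (gtI a b); last exact: X0.
  by have := M a b; rewrite t1 mul1r => ->; apply: Y0; rewrite // /ltI -leqNgt ltnW.
have h1 := torus_word_inj wh pih.
have x21 : x2' = 1.
  apply: (@rel_word_inj gtI (fun c => m - c)) pix => //.
  - by move=> c d /= E'; apply: val_inj => /=; have := ltn_ord c; have := ltn_ord d; lia.
  - by move=> c d; rewrite /gtI; have := ltn_ord c; lia.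
  - by move=> c; apply: leq_subr.
have y1 : y = 1.
  apply: (@rel_word_inj ltI val) => //.
  - exact: val_inj.
  - by move=> c; apply/ltnW/ltn_ord.
  - by rewrite -E [pi (h * x2')]gmulfM pih pix mulg1.
have x2E : x2 = 1 by move: x21; rewrite /x2' h1 invg1 mul1g invg1 mulg1.
rewrite x2E h1 !mulg1; apply: (mulgI x1^-1); apply: (mulIg x3^-1).
by rewrite mulKg mulgV mulg1 -/y y1.
Qed.

End Symbols.
End Steinberg.

(** * Elementary matrices *)

Section Elementary.
Variables (R : comNzRingType) (m : nat).
Implicit Types (a b c d : 'I_m) (r : R).

Definition elem_SL a b r : SL R m := insubd (1 : SL R m) (elem_mx a b r).

Lemma elem_SLE a b r : a != b -> SL_mx (elem_SL a b r) = elem_mx a b r.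
Proof.
by move=> ab; rewrite -[LHS]/(val _) val_insubd det_elem_mx // eqxx.
Qed.

Lemma elem_SL_mul a b r (A : SL R m) i j : a != b ->
  SL_mx (elem_SL a b r * A) i j = (A i j + (i == a)%:R * (r * A b j))%R.
Proof. by move=> ab; rewrite /= elem_SLE // elem_mulmx. Qed.

Lemma elem_SLD a b r r' : a != b ->
  elem_SL a b (r + r')%R = elem_SL a b r * elem_SL a b r'.
Proof.
move=> ab; apply: val_inj; apply/matrixP => i j.
rewrite -[LHS]/(SL_mx _ i j) -[elem_SL a b (r + r')%R]mulg1.
rewrite -[elem_SL a b r']mulg1 !elem_SL_mul // (eq_sym b) (negPf ab) mulr0n; ring.
Qed.

Lemma elem_SL0 a b : a != b -> elem_SL a b 0%R = 1.
Proof.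
move=> ab; apply: (mulgI (elem_SL a b 0%R)).
by rewrite -elem_SLD // addr0 mulg1.
Qed.

Lemma elem_SL_commute a b c d r r' : a != b -> c != d -> b != c -> a != d ->
  commute (elem_SL a b r) (elem_SL c d r').
Proof.
move=> ab cd bc ad; apply: val_inj; apply/matrixP => i j.
rewrite -[elem_SL a b r * _]mulg1 -[elem_SL c d r' * _]mulg1 -!mulgA.
rewrite -[LHS]/(SL_mx _ i j) -[RHS]/(SL_mx _ i j) !elem_SL_mul //.
by rewrite (negPf bc) (eq_sym d) (negPf ad) mulr0n; ring.
Qed.

Lemma elem_SL_cm a b c r r' : a != b -> b != c -> a != c ->
  cm (elem_SL a b r) (elem_SL b c r') = elem_SL a c (r * r')%R.
Proof.
move=> ab bc ac; apply/cmP; apply: val_inj; apply/matrixP => i j.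
rewrite -[elem_SL a b r * _]mulg1 -[elem_SL b c r' * _]mulg1 -!mulgA.
rewrite -[LHS]/(SL_mx _ i j) -[RHS]/(SL_mx _ i j) !elem_SL_mul //.
rewrite !eqxx (eq_sym c b) (eq_sym c a) (negPf bc).
by rewrite (negPf ac) mulr0n mulr1n; ring.
Qed.

End Elementary.

(** * Truncated polynomials *)

HB.instance Definition _ p s := GRing.ComUnitRing.copy (Fpt_mod p s)
  {poly %/ ('X^s : {poly 'F_p})%R}.

Lemma Fp_poly_ind p (P : {poly 'F_p} -> Prop) : P 0%R ->
    (forall f g, P f -> P g -> P (f + g)%R) -> (forall k, P 'X^k%R) ->
  forall f, P f.
Proof.
move=> P0 PD PX f; rewrite -[f]coefK poly_def.
apply: big_ind => // k _; rewrite -[f`_k]natr_Zp scaler_nat.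
move: (nat_of_ord f`_k) => n.
by elim: n => [|n IHn]; rewrite ?mulr0n // mulrS; apply: PD.
Qed.

Section Truncated.
Variables (p s : nat).
Hypotheses (p_prime : prime p) (s_gt0 : 0 < s).
Local Notation R := (Fpt_mod p s).
Local Notation red := (reduction p s).
Implicit Types (r : R) (f g : {poly 'F_p}).

Definition lift_poly r : {poly 'F_p} := val r.

Lemma reductionK r : red (lift_poly r) = r.
Proof. exact/val_inj/in_qpoly_small/size_mk_monic. Qed.

Lemma lift_reduction f : lift_poly (red f) = Pdiv.CommonRing.rmodp f 'X^s.
Proof. by rewrite /lift_poly /= mk_monic_Xn prednK. Qed.

Lemma lift_reduction_eq f : exists q, f = (q * 'X^s + lift_poly (red f))%R.
Proof.
rewrite lift_reduction; exists (Pdiv.CommonRing.rdivp f 'X^s).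
exact: Pdiv.RingMonic.rdivp_eq (monicXn _ _) f.
Qed.

Lemma coef_lift_reduction f k : k < s -> (lift_poly (red f))`_k = f`_k.
Proof.
move=> ks; have [q {2}->] := lift_reduction_eq f.
by rewrite coefD coefMXn ks add0r.
Qed.

Lemma reduction_Xn k : s <= k -> red 'X^k%R = 0%R.
Proof.
move=> sk; have redXs : red 'X^s%R = 0%R.
  rewrite -[LHS]reductionK lift_reduction Pdiv.RingMonic.rmodpp ?monicXn //.
  by rewrite rmorph0.
by rewrite -(subnK sk) exprD rmorphM redXs mulr0.
Qed.

Definition residue r : 'F_p := (lift_poly r)`_0.

Lemma residue_reduction f : residue (red f) = f`_0%R.
Proof. exact: coef_lift_reduction. Qed.

Lemma residue_zmod : zmod_morphism residue.
Proof.
move=> r r'; rewrite -[r]reductionK -[r']reductionK -rmorphB.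
by rewrite !residue_reduction coefB.
Qed.

Lemma residue_monoid : monoid_morphism residue.
Proof.
split=> [|r r']; first by rewrite -(rmorph1 red) residue_reduction coef1.
rewrite -[r]reductionK -[r']reductionK -rmorphM.
by rewrite !residue_reduction coef0M.
Qed.

HB.instance Definition _ := GRing.isZmodMorphism.Build R 'F_p residue residue_zmod.
HB.instance Definition _ := GRing.isMonoidMorphism.Build R 'F_p residue residue_monoid.

Definition constant : 'F_p -> R := red \o polyC.
HB.instance Definition _ := GRing.RMorphism.on constant.

Lemma constantK : cancel constant residue.
Proof. by move=> c; rewrite /constant /= residue_reduction coefC. Qed.

(** [r - 1] is divisible by [t], hence nilpotent, and [p ^ s]-th powers are
additive. *)
Lemma residue_unipotent r : residue r = 1%R ->
  exists N, (r ^+ (p ^ N))%R = 1%R.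
Proof.
move=> r1; exists s.
have pR : p \in [pchar R]%R.
  by apply: (rmorph_pchar constant); apply: pchar_Fp.
rewrite -[r](subrK 1%R) exprDn_pchar; last first.
  by rewrite pnatX (pnatE _ p_prime) pR.
rewrite expr1n; set y := (r - 1)%R.
suff -> : (y ^+ (p ^ s) = 0)%R by rewrite add0r.
have y0 : residue y = 0%R by rewrite rmorphB /= r1 rmorph1 subrr.
have : root (lift_poly y) 0%R by rewrite /root horner_coef0; apply/eqP.
case/factor_theorem => q; rewrite subr0 => yE.
rewrite -[y]reductionK yE rmorphM exprMn -[(red 'X ^+ _)%R]rmorphXn /=.
by rewrite reduction_Xn ?mulr0 // ltnW // ltn_expl // prime_gt1.
Qed.

Lemma residue_unit r : (r \is a GRing.unit) = (residue r != 0%R).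
Proof.
apply/idP/idP => [rU|r0]; first by rewrite -unitfE rmorph_unit.
have r1 : residue (constant (residue r)^-1 * r)%R = 1%R.
  by rewrite rmorphM /= constantK mulVf.
have [N rN] := residue_unipotent r1.
have : (constant (residue r)^-1 * r)%R \is a GRing.unit.
  by rewrite -(@unitrX_pos _ _ (p ^ N)) ?rN ?unitr1 // expn_gt0 prime_gt0.
by rewrite unitrM => /andP[].
Qed.

End Truncated.

(** * From graded relations to relations over the truncated ring *)

Section GradedToRing.
Variables (p s m : nat) (G : groupType).
Local Notation R := (Fpt_mod p s).
Local Notation red := (reduction p s).
Hypotheses (p_prime : prime p) (s_gt0 : 0 < s).
Variables (pi : UMagmaMorphism.type G (SL R m)) (x : 'I_m -> 'I_m -> nat -> G).
Hypothesis stx : forall D, steinberg_upto p D x.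
Hypothesis xpi : forall a b k, a != b ->
  pi (x a b k) = elem_SL a b (red 'X^k%R).
Hypothesis xs : forall a b k, a != b -> s <= k -> x a b k = 1.
Implicit Types (a b c d : 'I_m) (f g : {poly 'F_p}) (r : R).

Let xE a b k : a != b -> x a b k ^+ p = 1.
Proof. by move=> ab; apply: (st_exp (stx k)). Qed.

Let xC a b c d i j : a != b -> c != d -> b != c -> a != d ->
  commute (x a b i) (x c d j).
Proof.
by move=> *; apply: (st_comm (stx (i + j))) => //; rewrite ?leq_addr ?leq_addl.
Qed.

Lemma expg_FpD (y : G) (c d : 'F_p) : y ^+ p = 1 ->
  y ^+ (c + d)%R = y ^+ c * y ^+ d.
Proof.
move=> yp; rewrite -expgnDr [in RHS](divn_eq (c + d) p) expgnDr mulnC expgnA yp.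
rewrite expg1n mul1g; congr (y ^+ _) => /=; congr (_ %% _)%N.
exact: Fp_cast.
Qed.

(** The lift of the elementary matrix with entry [f]; the exponents are the
representatives of the coefficients of [f]. *)
Definition poly_root a b f := \prod_(k < s) x a b k ^+ (f`_k)%R.

Lemma poly_root_commute a b c d f g : a != b -> c != d -> b != c -> a != d ->
  commute (poly_root a b f) (poly_root c d g).
Proof.
move=> ab cd bc ad; apply: commute_prod => i _; apply/commute_sym.
by apply: commute_prod => j _; apply: commuteX2; apply: xC; ne.
Qed.

Lemma poly_rootD a b f g : a != b ->
  poly_root a b (f + g)%R = poly_root a b f * poly_root a b g.
Proof.
move=> ab; rewrite /poly_root -prodgM_commute.
  by apply: eq_bigr => k _; rewrite coefD expg_FpD ?xE.
by move=> i j *; apply: commuteX2; apply: xC; ne.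
Qed.

Lemma poly_root_eq a b f g : (forall k, k < s -> (f`_k = g`_k)%R) ->
  poly_root a b f = poly_root a b g.
Proof. by move=> fg; apply: eq_bigr => k _; rewrite fg. Qed.

Lemma poly_root0 a b : poly_root a b 0%R = 1.
Proof. by rewrite /poly_root big1 // => k _; rewrite coef0. Qed.

Lemma poly_rootXn a b k : a != b -> poly_root a b 'X^k%R = x a b k.
Proof.
move=> ab; have [ks|sk] := ltnP k s; last first.
  rewrite xs // -(poly_root0 a b); apply: poly_root_eq => j js.
  by rewrite coefXn coef0 ltn_eqF //; apply: leq_trans sk.
have <- : \prod_(j < s | j == Ordinal ks) x a b j = x a b k.
  by rewrite big_pred1_eq.
rewrite [RHS]big_mkcond; apply: eq_bigr => j _; rewrite coefXn -val_eqE /=.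
by case: eqP => _; rewrite ?expg0 // /= modn_small ?expg1 // Fp_cast // prime_gt1.
Qed.

(** The relation is biadditive in [f] and [g] because its values commute with
the factors, which reduces it to monomials. *)
Lemma poly_root_cm a b c f g : a != b -> b != c -> a != c ->
  cm (poly_root a b f) (poly_root b c g) = poly_root a c (f * g)%R.
Proof.
move=> ab bc ac; elim/Fp_poly_ind: f => [|f f' IHf IHf'|i].
- by rewrite poly_root0 mul0r poly_root0 cm1g.
- rewrite poly_rootD // mulrDl addrC poly_rootD // -IHf -IHf'.
  have -> (h1 h2 k : G) : cm (h1 * h2) k = h1 * cm h2 k * h1^-1 * cm h1 k.
    by rewrite /cm !gnorm.
  congr (_ * _); apply/commute_conjE; rewrite IHf'.
  by apply: poly_root_commute; ne.
elim/Fp_poly_ind: g => [|g g' IHg IHg'|j].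
- by rewrite poly_root0 mulr0 poly_root0 cmg1.
- rewrite poly_rootD // mulrDr poly_rootD // -IHg -IHg'.
  have -> (h k1 k2 : G) : cm h (k1 * k2) = cm h k1 * (k1 * cm h k2 * k1^-1).
    by rewrite /cm !gnorm.
  congr (_ * _); apply/commute_conjE; rewrite IHg'.
  by apply: poly_root_commute; ne.
rewrite -exprD !poly_rootXn //.
exact: (st_cm (stx (i + j))).
Qed.

Lemma poly_root_pi a b f : a != b -> pi (poly_root a b f) = elem_SL a b (red f).
Proof.
move=> ab; elim/Fp_poly_ind: f => [|f g IHf IHg|k].
- by rewrite poly_root0 gmulf1 rmorph0 elem_SL0.
- rewrite (poly_rootD _ _ ab) gmulfM IHf IHg -(elem_SLD _ _ ab).
  by congr elem_SL; rewrite [RHS]rmorphD.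
- by rewrite poly_rootXn // xpi.
Qed.

Definition ring_root a b r := poly_root a b (lift_poly r).

Lemma ring_root_reduction a b f : ring_root a b (red f) = poly_root a b f.
Proof. by apply: poly_root_eq => k ks; rewrite coef_lift_reduction. Qed.

Lemma ring_root_steinberg : steinberg pi ring_root.
Proof.
split=> [a b r r' ab|a b c d r r'|a b c r r'|a b r ab].
- rewrite -[r in LHS]reductionK -[r' in LHS]reductionK -rmorphD.
  by rewrite ring_root_reduction poly_rootD.
- exact: poly_root_commute.
- move=> ab bc ac; rewrite -[r in RHS]reductionK -[r' in RHS]reductionK -rmorphM.
  by rewrite ring_root_reduction -(@poly_root_cm a b c).
- by rewrite /ring_root poly_root_pi // reductionK elem_SLE.
Qed.

End GradedToRing.

(** * Injectivity from the relations along a cycle *)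
Section CyclicPresentation.
Variables (p s m D : nat) (G : groupType).
Hypotheses (p_prime : prime p) (p_odd : odd p) (s_gt0 : 0 < s) (m_ge4 : 3 < m).
Hypothesis D_gt0 : 0 < D.
Variables (pi : UMagmaMorphism.type G (SL (Fpt_mod p s) m)).
Hypothesis torsion : forall g, pi g = 1 -> g ^+ p = 1 -> g = 1.
Variable x : 'I_m -> 'I_m -> nat -> G.
Hypothesis xE : forall a b i, a != b -> i <= D -> x a b i ^+ p = 1.
Hypothesis xC : forall t a b c d i j, cyc_lt t a b -> cyc_lt t c d ->
  b != c -> a != d -> i <= D -> j <= D -> commute (x a b i) (x c d j).
Hypothesis xM : forall t a b c i j, cyc_lt t a b -> cyc_lt t b c ->
  i + j <= D -> cm (x a b i) (x b c j) = x a c (i + j).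
Hypothesis xpi : forall a b k, a != b -> k <= D ->
  pi (x a b k) = elem_SL a b (reduction p s 'X^k%R).

Lemma fourth_index (a b c : 'I_m) : exists d, [&& d != a, d != b & d != c].
Proof.
have /card_gt0P[d] : 0 < #|~: [set a; b; c]|.
  rewrite cardsCs finset.setCK card_ord subn_gt0.
  apply: leq_ltn_trans m_ge4; rewrite -finset.setUA cardsU1 cards2.
  by case: (_ \notin _); case: (_ != _).
by rewrite !inE !negb_or -andbA; exists d.
Qed.

Lemma cyclic_presentation_injective g :
    word (fun h => exists a b k, [/\ a != b, k <= D & h = x a b k]) g ->
  pi g = 1 -> g = 1.
Proof.
have piM a b c i j : a != b -> b != c -> a != c ->
    cm (elem_SL a b (reduction p s 'X^i%R)) (elem_SL b c (reduction p s 'X^j%R))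
    = elem_SL a c (reduction p s 'X^(i + j)%R).
  move=> ab bc ac; rewrite (elem_SL_cm _ _ ab bc ac); congr elem_SL.
  by rewrite -[LHS]rmorphM exprD.
have stD : steinberg_upto p D x.
  apply: (steinberg_of_cyclic p_odd m_ge4 torsion xE xC xM).
  move=> a b c i j ab bc ac ijD; rewrite !xpi ?piM //; lia.
have [y [yx stY]] := steinberg_extend p_odd fourth_index D_gt0 stD.
have ypi a b k : a != b -> pi (y a b k) = elem_SL a b (reduction p s 'X^k%R).
  have [n] := ubnP k; elim: n k a b => // n IHn k a b kn ab.
  have [kD|Dk] := leqP k D; first by rewrite yx // xpi.
  have [c /and3P[ca cb _]] := fourth_index a b b.
  case: k kn Dk => // k kn Dk.
  have {1}-> : k.+1 = 1 + k by [].
  rewrite -(@st_cm _ _ _ _ _ (stY k.+1) a c b) //; try ne.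
  rewrite /cm !(gmulfM, gmulfV) -/(cm _ _) !IHn ?piM //; try ne.
(* In degrees at least [s] the root elements lie over 1 and have exponent
   [p]. *)
have ys a b k : a != b -> s <= k -> y a b k = 1.
  move=> ab sk; apply: torsion; last exact: (st_exp (stY k)).
  by rewrite ypi // reduction_Xn // elem_SL0.
have third (a b : 'I_m) : exists c, (c != a) && (c != b).
  by have [d /and3P[da db _]] := fourth_index a b b; exists d; rewrite da.
have stR := ring_root_steinberg p_prime s_gt0 stY ypi ys.
move=> wg; apply: (steinberg_injective third stR p_prime p_odd
  (residue_unit p_prime s_gt0) (constantK s_gt0)
  (residue_unipotent p_prime s_gt0) torsion); first exact: s_gt0.
apply: word_sub wg => _ [a [b [k [ab kD ->]]]]; apply: word_gen.
exists a, b, (reduction p s 'X^k%R); split=> //.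
by rewrite ring_root_reduction // poly_rootXn // yx.
Qed.

End CyclicPresentation.

(** * The holonomy group *)

Section Holonomy.
Variables (B L : groupType).

(** The element with components [g] and [f] is the transformation
[(h, l) |-> (h * g, l * f h)] of [B * L]; transformations compose from left to
right. *)
Record holonomy := Holonomy { hol_base : B; hol_fun : B -> L }.

HB.instance Definition _ := gen_eqMixin holonomy.
HB.instance Definition _ := gen_choiceMixin holonomy.

Implicit Types x y z : holonomy.

Lemma holonomy_eq x y : hol_base x = hol_base y -> hol_fun x =1 hol_fun y ->
  x = y.
Proof. by case: x y => [g f] [g' f'] /= -> /funext ->. Qed.

Definition hol_one := Holonomy 1 (fun=> 1).
Definition hol_mul x y := Holonomy (hol_base x * hol_base y)
  (fun h => hol_fun x h * hol_fun y (h * hol_base x)).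
Definition hol_inv x := Holonomy (hol_base x)^-1
  (fun h => (hol_fun x (h * (hol_base x)^-1))^-1).

Fact hol_mulA : associative hol_mul.
Proof. by move=> x y z; apply: holonomy_eq => [|h] /=; rewrite !mulgA. Qed.
Fact hol_mul1 : left_id hol_one hol_mul.
Proof. by move=> x; apply: holonomy_eq => [|h] /=; rewrite ?mulg1 mul1g. Qed.
Fact hol_mulr1 : right_id hol_one hol_mul.
Proof. by move=> x; apply: holonomy_eq => [|h] /=; rewrite mulg1. Qed.
Fact hol_mulV : left_inverse hol_one hol_inv hol_mul.
Proof. by move=> x; apply: holonomy_eq => [|h] /=; rewrite mulVg. Qed.
Fact hol_mulrV : right_inverse hol_one hol_inv hol_mul.
Proof. by move=> x; apply: holonomy_eq => [|h] /=; rewrite ?mulgK mulgV. Qed.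

HB.instance Definition _ :=
  isGroup.Build holonomy hol_mulA hol_mul1 hol_mulr1 hol_mulV hol_mulrV.

Fact hol_baseF : {morph hol_base : x y / x * y^-1}.
Proof. by []. Qed.
HB.instance Definition _ :=
  isGroupMorphism.Build holonomy B hol_base hol_baseF.

Lemma hol_fun_exp x n h : hol_base x = 1 ->
  hol_fun (x ^+ n) h = hol_fun x h ^+ n.
Proof.
move=> x1; elim: n h => [|n IHn] h //.
by rewrite !expgS /= x1 mulg1 IHn.
Qed.

End Holonomy.

Lemma has_order_prime (L : groupType) (x : L) p : prime p -> x ^+ p = 1 ->
  x <> 1 -> has_order x p.
Proof.
move=> p_prime xp x1; split=> [|//|e /andP[e0 ep] xe]; first exact: prime_gt0.
apply: x1; have ce : coprime e p.
  rewrite coprime_sym prime_coprime //; apply/negP => /(dvdn_leq e0).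
  by rewrite leqNgt ep.
case: (egcdnP p e0) => k l kE _; rewrite (eqP ce) in kE.
have := congr1 (fun j => x ^+ j) kE.
by rewrite /= expgnDr (mulnC k) (mulnC l) !expgnA xe xp !expg1n mul1g.
Qed.

(** * Trivialising a transport *)

Section Transport.
Variables (B L : groupType) (I : Type) (o : I) (V : Type).
(* [v i g] is the coset of [g] for [K i], and [F] is multiplicative on the
   triangles of each chamber. *)
Variables (K : I -> set B) (v : I -> B -> V) (F : V -> V -> L).
Hypothesis v_coset : forall i g k, K i k -> v i (g * k) = v i g.
Hypothesis F_trans : forall g i j k,
  F (v i g) (v j g) * F (v j g) (v k g) = F (v i g) (v k g).

Local Notation H := (holonomy B L).

(** Transport along the path through the cosets of [h] for [K o], of [h] and
[h * k] for [K i], and of [h * k] for [K o]. *)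
Definition transport_lift i k : H :=
  Holonomy k (fun h => F (v o h) (v i h) * F (v i h) (v o (h * k))).

Lemma F_refl i g : F (v i g) (v i g) = 1.
Proof. by apply: (mulgI (F (v i g) (v i g))); rewrite F_trans mulg1. Qed.

Lemma F_inv i j g : F (v i g) (v j g) = (F (v j g) (v i g))^-1.
Proof. by apply/esym/mulg1_eq; rewrite F_trans F_refl. Qed.

Lemma F_back i h k : K i k ->
  F (v i h) (v o (h * k)) * F (v o (h * k)) (v i h) = 1.
Proof. by move=> Kk; rewrite -(v_coset h Kk) F_trans F_refl. Qed.

Lemma transport_liftM i k k' : K i k ->
  transport_lift i (k * k') = transport_lift i k * transport_lift i k'.
Proof.
move=> Kk; apply: holonomy_eq => //= h; rewrite mulgA (v_coset _ Kk).
by rewrite [RHS]mulgA -(mulgA (F (v o h) (v i h))) F_back // mulg1.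
Qed.

Lemma transport_lift_indep i j k : K i k -> K j k ->
  transport_lift i k = transport_lift j k.
Proof.
move=> Ki Kj; apply: holonomy_eq => //= h.
rewrite -(F_trans h o j i) -mulgA; congr (_ * _).
by rewrite -(v_coset h Ki) -(v_coset h Kj) F_trans.
Qed.

Variable W : H -> Prop.
Hypotheses (W1 : W 1) (WM : forall x y, W x -> W y -> W (x * y)).
Hypothesis WV : forall x, W x -> W x^-1.
Hypothesis W_lift : forall i k, K i k -> W (transport_lift i k).
Hypothesis W_inj : forall x, W x -> hol_base x = 1 -> x = 1.

(* [W] acts on [B] through right multiplication.  As it acts freely, the path
   in [W] from the chosen point of an orbit to [g] is unique, and its holonomy is
   a function of [g]. *)
Let component g : set B := [set h | exists2 x, W x & h * hol_base x = g].
Let root_pt g := xget 1 (component g).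

Let component_root g : component g (root_pt g).
Proof. by apply: (@xgetPex _ 1 (component g)); exists g, 1; rewrite ?mulg1. Qed.

Let component_lift i g k : K i k -> component (g * k) = component g.
Proof.
move=> Kk; apply/seteqP; split=> h [x Wx hx].
  exists (x * (transport_lift i k)^-1); first by apply/WM/WV/W_lift.
  by rewrite /= mulgA hx mulgK.
exists (x * transport_lift i k); first by apply/WM/W_lift.
by rewrite /= mulgA hx.
Qed.

Let path g : H := xget 1 [set x | W x /\ root_pt g * hol_base x = g].

Let pathP g : W (path g) /\ root_pt g * hol_base (path g) = g.
Proof.
have [x Wx xg] := component_root g.
by apply: (@xgetPex _ 1 [set x | W x /\ root_pt g * hol_base x = g]); exists x.
Qed.

Let path_lift i g k : K i k -> path (g * k) = path g * transport_lift i k.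
Proof.
move=> Kk; have [W1' E1] := pathP (g * k); have [W2 E2] := pathP g.
have rE : root_pt (g * k) = root_pt g by rewrite /root_pt (component_lift _ Kk).
apply: divg1_eq; apply: W_inj; first by apply/WM/WV/WM/W_lift.
rewrite gmulfF gmulfM /=; apply/eqP; rewrite divg_eq1; apply/eqP.
apply: (mulgI (root_pt g)).
by rewrite mulgA E2 -{1}rE E1.
Qed.

Let holonomy_at g := hol_fun (path g) (root_pt g).

(** The transport from the base point of the component, first to [v o g] along
the path and then within the chamber of [g], depends only on [v i g]. *)
Lemma transport_trivial : exists mu : I -> B -> L,
  (forall i g k, K i k -> mu i (g * k) = mu i g) /\
  (forall i j g, F (v i g) (v j g) = (mu i g)^-1 * mu j g).
Proof.
exists (fun i g => holonomy_at g * F (v o g) (v i g)); split=> [i g k Kk|i j g].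
  have [_ E] := pathP g.
  have rE : root_pt (g * k) = root_pt g by rewrite /root_pt (component_lift _ Kk).
  rewrite /holonomy_at rE (path_lift _ Kk) /= E -!mulgA; congr (_ * _).
  by rewrite (v_coset g Kk) F_back ?mulg1.
by rewrite /= invgM -mulgA mulKg -F_inv F_trans.
Qed.

End Transport.

(** * Cocycles on coset complexes *)

Lemma H1_trivialP (X : simplicial_complex) (L : groupType) :
    (forall phi : @oedge X -> L, Z1 phi ->
      exists psi : vertex X -> L, forall e : @oedge X,
        phi e = psi (val e).1 * (psi (val e).2)^-1) ->
  H1_trivial X L.
Proof.
move=> coboundary.
have orbit_eq (phi : @oedge X -> L) : Z1 phi ->
    cochain_orbit phi = cochain_orbit (fun=> 1).
  move=> /coboundary[psi psiE]; apply/seteqP; split=> _ [chi _ <-].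
    exists (fun u => chi u * psi u) => //; apply/funext => e.
    by rewrite /cochain_act psiE mulg1 invgM !mulgA.
  exists (fun u => chi u * (psi u)^-1) => //; apply/funext => e.
  by rewrite /cochain_act psiE mulg1 invgM invgK !mulgA mulgVK mulgVK.
apply/seteqP; split=> [_ [phi phiZ <-]|_ ->]; first exact: orbit_eq.
exists (fun=> 1) => //; split=> [e|t]; first by rewrite invg1.
by rewrite !mulg1.
Qed.

Section CosetCocycle.
Variables (B L : groupType) (m : nat) (K : 'I_m -> subgroup B).
Local Notation X := (coset_complex K).
Implicit Types (i j k : 'I_m) (g : B).

Lemma subgroup1 (P : subgroup B) : subgroup_set P 1.
Proof. by have [P1 _] := subgroup_closed P; rewrite inE in P1. Qed.

Lemma subgroupM (P : subgroup B) g h : subgroup_set P g -> subgroup_set P h ->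
  subgroup_set P (g * h).
Proof.
have := group_closedM (subgroup_closed P) => /(_ g h).
by rewrite !inE; apply.
Qed.

Lemma subgroupV (P : subgroup B) g : subgroup_set P g -> subgroup_set P g^-1.
Proof.
by have := group_closedV (subgroup_closed P) => /(_ g); rewrite !inE; apply.
Qed.

Lemma left_coset_eq (P : subgroup B) g h : subgroup_set P h ->
  left_coset P (g * h) = left_coset P g.
Proof.
move=> Ph; apply/seteqP; split=> _ [k Pk <-].
  by exists (h * k); rewrite ?mulgA //; apply: subgroupM.
by exists (h^-1 * k); rewrite -?mulgA ?mulVKg //; apply/subgroupM/Pk/subgroupV.
Qed.

Lemma coset_vertex_subproof i g : (i, left_coset (K i) g) \in coset_vertex K.
Proof. by rewrite inE; exists g. Qed.

Definition coset_pt i g : vertex X := SigSub (coset_vertex_subproof i g).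

Lemma coset_pt_mul i g h : subgroup_set (K i) h ->
  coset_pt i (g * h) = coset_pt i g.
Proof. by move=> Kh; apply: val_inj; rewrite /= left_coset_eq. Qed.

Lemma coset_ptP (u : vertex X) g : (val u).2 g -> u = coset_pt (val u).1 g.
Proof.
have [g0 uE] := set_mem (valP u); rewrite uE => -[h Kh <-]; apply: val_inj.
by rewrite /= left_coset_eq // -uE -surjective_pairing.
Qed.

Lemma coset_pt_mem i g : (val (coset_pt i g)).2 g.
Proof. by exists 1; rewrite ?mulg1 //; apply: subgroup1. Qed.

Lemma oedge_common (e : @oedge X) : exists i j g,
  (val e).1 = coset_pt i g /\ (val e).2 = coset_pt j g.
Proof.
case: e => -[u v] /= /set_mem[/= _ [_ uvX]].
have [_ [g [/= ug vg]]] := uvX u v (or_introl erefl) (or_intror erefl).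
by exists (val u).1, (val v).1, g; split; apply: coset_ptP.
Qed.

Lemma coset_pt_neq i j g : i != j -> coset_pt i g <> coset_pt j g.
Proof. by move=> ij /(congr1 (fun u => (val u).1)) /= /eqP; rewrite (negPf ij). Qed.

Lemma coset_pt_simplex (A : set (vertex X)) g : (A !=set0)%classic ->
  (forall u, A u -> exists i, u = coset_pt i g) -> simplex A.
Proof.
move=> A0 AP; split=> // u v /AP[i ->] /AP[j ->]; split=> [/= ->//|].
by exists g; split; apply: coset_pt_mem.
Qed.

Variable phi : @oedge X -> L.
Hypothesis phiZ : Z1 phi.

(** The cocycle as a function on all pairs of vertices, in particular on pairs of
equal ones, where it must be 1. *)
Definition transport (u v : vertex X) : L :=
  if pselect ((u, v) \in @oedge X) is left e then phi (SigSub e) else 1.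

Lemma transportE (e : @oedge X) : phi e = transport (val e).1 (val e).2.
Proof.
rewrite /transport; case: pselect => [e'|[]].
  by congr phi; apply: val_inj; rewrite /= -surjective_pairing.
by rewrite -surjective_pairing; apply: (valP e).
Qed.

Lemma transport_refl u : transport u u = 1.
Proof. by rewrite /transport; case: pselect => // -/[dup] /set_mem[]. Qed.

Lemma coset_pt_oedge i j g : i != j ->
  (coset_pt i g, coset_pt j g) \in @oedge X.
Proof.
move=> ij; rewrite inE; split=> /=; first exact: coset_pt_neq.
apply: (@coset_pt_simplex _ g); first by exists (coset_pt i g); left.
by move=> u [->|->]; [exists i|exists j].
Qed.

Lemma transport_inv i j g :
  transport (coset_pt i g) (coset_pt j g) *
  transport (coset_pt j g) (coset_pt i g) = 1.
Proof.
have [->|ij] := eqVneq i j; first by rewrite !transport_refl mulg1.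
pose e : @oedge X := SigSub (coset_pt_oedge g ij).
have := phiZ.1 e; rewrite !transportE /= => ->; exact: mulVg.
Qed.

Lemma transport_trans g i j k :
  transport (coset_pt i g) (coset_pt j g) *
  transport (coset_pt j g) (coset_pt k g) =
  transport (coset_pt i g) (coset_pt k g).
Proof.
have [->|ij] := eqVneq i j; first by rewrite transport_refl mul1g.
have [->|jk] := eqVneq j k; first by rewrite transport_refl mulg1.
have [->|ki] := eqVneq k i; first by rewrite transport_inv transport_refl.
have tP : (coset_pt i g, coset_pt j g, coset_pt k g) \in @otriangle X.
  rewrite inE; split=> /=; try exact: coset_pt_neq.
  apply: (@coset_pt_simplex _ g); first by exists (coset_pt i g); left; left.
  by move=> u [[->|->]|->]; [exists i|exists j|exists k].
have := phiZ.2 (SigSub tP); rewrite !transportE /= => E.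
by apply: (mulIg (transport (coset_pt k g) (coset_pt i g))); rewrite E transport_inv.
Qed.

Lemma coset_cocycle_trivial (mu : 'I_m -> B -> L) :
    (forall i g h, subgroup_set (K i) h -> mu i (g * h) = mu i g) ->
    (forall i j g, transport (coset_pt i g) (coset_pt j g) =
                   (mu i g)^-1 * mu j g) ->
  exists psi : vertex X -> L, forall e : @oedge X,
    phi e = psi (val e).1 * (psi (val e).2)^-1.
Proof.
move=> mu_coset muE.
pose psi (u : vertex X) := (mu (val u).1 (xget 1 (val u).2))^-1.
have psiE i g : psi (coset_pt i g) = (mu i g)^-1.
  rewrite /psi; congr _^-1.
  have : (val (coset_pt i g)).2 (xget 1 (val (coset_pt i g)).2).
    by apply: xgetPex; exists g; apply: coset_pt_mem.
  by move=> [h Kh <-]; apply: mu_coset.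
exists psi => e; have [i [j [g [e1 e2]]]] := oedge_common e.
by rewrite transportE e1 e2 !psiE invgK muE.
Qed.

Section Walk.
Variable o : 'I_m.

Definition walk i (k : B) : holonomy B L :=
  transport_lift o coset_pt transport i k.

Let Kset i : set B := subgroup_set (K i).
Let Kset_coset i g (k : B) : Kset i k -> coset_pt i (g * k) = coset_pt i g.
Proof. exact: coset_pt_mul. Qed.

Lemma walkM i (k k' : B) : subgroup_set (K i) k ->
  walk i (k * k') = walk i k * walk i k'.
Proof. exact: (transport_liftM o Kset_coset transport_trans). Qed.

Lemma walk_indep i j (k : B) : subgroup_set (K i) k -> subgroup_set (K j) k ->
  walk i k = walk j k.
Proof. exact: (transport_lift_indep o Kset_coset transport_trans). Qed.

Lemma walk1 i : walk i 1 = 1.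
Proof.
by apply: (mulgI (walk i 1)); rewrite mulg1 -walkM ?mulg1 //; apply: subgroup1.
Qed.

Lemma walkV i (k : B) : subgroup_set (K i) k -> walk i k^-1 = (walk i k)^-1.
Proof. by move=> Kk; apply/esym/mulg1_eq; rewrite -walkM // mulgV walk1. Qed.

Lemma walkX i (k : B) e : subgroup_set (K i) k -> walk i (k ^+ e) = walk i k ^+ e.
Proof.
move=> Kk; elim: e => [|e IHe]; first exact: walk1.
by rewrite !expgS walkM // IHe.
Qed.

Lemma walk_cm i (k k' : B) : subgroup_set (K i) k -> subgroup_set (K i) k' ->
  walk i (cm k k') = cm (walk i k) (walk i k').
Proof.
move=> Kk Kk'; have KkV := subgroupV Kk; have KkV' := subgroupV Kk'.
by rewrite /cm !walkM ?walkV //; do ?apply: subgroupM.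
Qed.

Lemma walk_commute i (k k' : B) : subgroup_set (K i) k ->
  subgroup_set (K i) k' -> commute k k' -> commute (walk i k) (walk i k').
Proof. by move=> Kk Kk' kk'; rewrite /commute -!walkM // kk'. Qed.

Lemma walk_cocycle_trivial (W : holonomy B L -> Prop) :
    W 1 -> (forall x y, W x -> W y -> W (x * y)) -> (forall x, W x -> W x^-1) ->
    (forall i (k : B), subgroup_set (K i) k -> W (walk i k)) ->
    (forall x, W x -> hol_base x = 1 -> x = 1) ->
  exists psi : vertex X -> L, forall e : @oedge X,
    phi e = psi (val e).1 * (psi (val e).2)^-1.
Proof.
move=> W1 WM WV W_walk W_inj.
have [mu [mu_coset muE]] := transport_trivial Kset_coset transport_trans
  W1 WM WV W_walk W_inj.
exact: coset_cocycle_trivial mu_coset muE.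
Qed.

End Walk.

End CosetCocycle.

(** * The subgroups of the coset complex *)

Section CyclicSubgroups.
Variables (p n : nat).
Implicit Types (a b c t : 'I_n.+1) (r : {poly 'F_p}).

Lemma gamma0X (i : nat) c : (gamma0 n ^+ i) c = (c + i) %% n.+1 :> nat.
Proof.
rewrite permX; elim: i => [|i IHi] /=; first by rewrite addn0 modn_small.
by rewrite permE /= IHi -[X in X %% _]addn1 modnDml -addnA addn1.
Qed.

Lemma gen_sub (G : groupType) (S : set G) s : S s -> subgroup_set (Defs.generated S) s.
Proof. by move=> Ss H [_ HS]; apply: HS. Qed.

Lemma subgroup_cm (G : groupType) (P : subgroup G) g h :
  subgroup_set P g -> subgroup_set P h -> subgroup_set P (cm g h).
Proof. by move=> Pg Ph; do 3?[apply: subgroupM] => //; apply: subgroupV. Qed.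

(** Roots that are positive after the cycle is cut before [t] are iterated
commutators of the generators of [K_poly p t]; all factors but one can be taken
of degree 0. *)
Lemma K_poly_elem t a b r : cyc_lt t a b -> size r <= 4 ->
  subgroup_set (K_poly p t) (elem_SL a b r).
Proof.
have [k] := ubnP (cyc_pos t b - cyc_pos t a).
elim: k a b r => // k IHk a b r le_k ab r4.
have am := ltn_ord a; have bm := ltn_ord b; have tm := ltn_ord t.
have posn c : cyc_pos t c < n.+1.
  by have := ltn_ord c; rewrite /cyc_pos; case: ifP; lia.
have posE c : (cyc_pos t c + t) %% n.+1 = c.
  have cm := ltn_ord c; rewrite /cyc_pos; case: ifP => tc.
    by rewrite subnK // modn_small.
  by rewrite subnK; [rewrite modnDr modn_small | lia].
have anb : a != b by apply: contraTneq ab => ->; rewrite /cyc_lt ltnn.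
have [bS|bS] := eqVneq (cyc_pos t b) (cyc_pos t a).+1.
  have jn : cyc_pos t a < n by have := posn b; rewrite bS.
  apply: gen_sub; exists (Ordinal jn), r; split=> //.
  rewrite elem_SLE //; congr elem_mx; apply: val_inj; rewrite /= gamma0X /=.
    by rewrite posE.
  by rewrite /bump leq0n add1n -bS posE.
have [e eE] : exists e, cyc_pos t e = (cyc_pos t a).+1.
  by apply: cyc_posP; have := posn b; move: ab bS; rewrite /cyc_lt; lia.
have ae : cyc_lt t a e by rewrite /cyc_lt eE.
have eb : cyc_lt t e b by move: ab bS; rewrite /cyc_lt eE; lia.
have ane : a != e by apply: contraTneq ae => ->; rewrite /cyc_lt ltnn.
have enb : e != b by apply: contraTneq eb => ->; rewrite /cyc_lt ltnn.
rewrite -[r]mulr1 -(elem_SL_cm _ _ ane enb anb); apply: subgroup_cm.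
  by apply: IHk => //; move: le_k eb; rewrite /cyc_lt; lia.
by apply: IHk => //; rewrite ?size_poly1 //; move: le_k ae ab; rewrite /cyc_lt; lia.
Qed.

Lemma K_poly_ind t (P : SL {poly 'F_p} n.+1 -> Prop) :
    P 1 -> (forall A B, P A -> P B -> P (A * B)) -> (forall A, P A -> P A^-1) ->
    (forall a b r, cyc_lt t a b -> size r <= 4 -> P (elem_SL a b r)) ->
  forall A, subgroup_set (K_poly p t) A -> P A.
Proof.
move=> P1 PM PV Pgen A KA; suff: [set C | P C]%classic A by [].
apply: KA; split.
  by split=> [|C D]; rewrite !inE // => PC PD; apply/PM/PV.
move=> C [j [r [r4 CE]]].
have jn := ltn_ord j; have tm := ltn_ord t.
pose a := (gamma0 n ^+ t) (widen_ord (leqnSn n) j).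
pose b := (gamma0 n ^+ t) (lift ord0 j).
have aE : a = (j + t) %% n.+1 :> nat by rewrite /a gamma0X.
have bE : b = (j.+1 + t) %% n.+1 :> nat by rewrite /b gamma0X /= /bump leq0n add1n.
have {}CE : SL_mx C = elem_mx a b r := CE.
clearbody a b.
have modE (c : 'I_n.+1) k : k < n.+1 -> c = (k + t) %% n.+1 :> nat ->
    cyc_pos t c = k.
  move=> kn cE; rewrite /cyc_pos cE.
  have [lt|ge] := ltnP (k + t) n.+1.
    by rewrite modn_small // leq_addl addnK.
  have -> : (k + t) %% n.+1 = k + t - n.+1.
    by rewrite -{1}(subnK ge) modnDr modn_small; lia.
  by case: ifP; lia.
have ab : cyc_lt t a b.
  by rewrite /cyc_lt (modE a j) ?(modE b j.+1); lia.
have anb : a != b by apply: contraTneq ab => ->; rewrite /cyc_lt ltnn.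
suff -> : C = elem_SL a b r by apply: Pgen.
by apply: val_inj; rewrite -[RHS]/(SL_mx _) elem_SLE.
Qed.

Variable s : nat.
Local Notation red := (reduction p s).

Lemma SL_map_elem a b r : a != b ->
  SL_map red (elem_SL a b r) = elem_SL a b (red r).
Proof.
move=> ab; apply: val_inj; rewrite -[RHS]/(SL_mx _) elem_SLE //= elem_SLE //.
apply/matrixP => i j; rewrite !mxE rmorphD rmorphM; congr (_ + _ * _)%R.
  by rewrite rmorph_nat.
by rewrite rmorph_nat.
Qed.

Lemma K_mod_elem t a b r : cyc_lt t a b -> size r <= 4 ->
  subgroup_set (K_mod p s t) (elem_SL a b (red r)).
Proof.
move=> ab r4; have anb : a != b.
  by apply: contraTneq ab => ->; rewrite /cyc_lt ltnn.
by exists (elem_SL a b r); [apply: K_poly_elem | apply: SL_map_elem].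
Qed.

End CyclicSubgroups.

Lemma elem_SLX (R : comNzRingType) m (a b : 'I_m) (r : R) k : a != b ->
  elem_SL a b r ^+ k = elem_SL a b (r *+ k)%R.
Proof.
move=> ab; elim: k => [|k IHk]; first by rewrite mulr0n elem_SL0.
by rewrite expgS IHk mulrS (elem_SLD _ _ ab).
Qed.

(** * Triviality of the cocycles *)
Section Main.
Variables (n s p : nat).
Hypotheses (n_ge3 : 3 <= n) (s_gt0 : 0 < s) (p_prime : prime p) (p_odd : odd p).
Variable L : groupType.
Hypothesis no_p_elt : ~ exists y : L, y <> 1 /\ has_order y p.

Local Notation B := (SL (Fpt_mod p s) n.+1).
Local Notation K := (@K_mod p n s).
Local Notation red := (reduction p s).
Local Notation H := (holonomy B L).

Lemma holonomy_torsion (g : H) : hol_base g = 1 -> g ^+ p = 1 -> g = 1.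
Proof.
move=> g1 gp; apply: holonomy_eq => [|h]; first exact: g1.
apply: contrapT => gh; apply: no_p_elt; exists (hol_fun g h); split=> //.
apply: has_order_prime => //.
by rewrite -hol_fun_exp // gp.
Qed.

Variable phi : @oedge (X_complex n p s) -> L.
Hypothesis phiZ : Z1 phi.

Local Notation walk := (@walk B L _ K phi ord0).

(** The choice of the subgroup of index [a] is immaterial by [walk_indep], but it
must contain the root [(a, b)]. *)
Definition root_elt (a b : 'I_n.+1) (k : nat) : H :=
  walk a (elem_SL a b (red 'X^k%R)).

Let size_Xk k : k <= 3 -> size ('X^k%R : {poly 'F_p}) <= 4.
Proof. by rewrite size_polyXn. Qed.

Let K_elem t a b k : cyc_lt t a b -> k <= 3 ->
  subgroup_set (K t) (elem_SL a b (red 'X^k%R)).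
Proof. by move=> ab k3; apply: (K_mod_elem _ ab); apply: size_Xk. Qed.

Let cyc_lt_self (a b : 'I_n.+1) : a != b -> cyc_lt a a b.
Proof.
have am := ltn_ord a; have bm := ltn_ord b.
by rewrite -val_eqE /cyc_lt /cyc_pos /= leqnn subnn; case: ifP; lia.
Qed.

Let cyc_lt_neq (t a b : 'I_n.+1) : cyc_lt t a b -> a != b.
Proof. by apply: contraTneq => ->; rewrite /cyc_lt ltnn. Qed.

Let root_eltE t a b k : cyc_lt t a b -> k <= 3 ->
  root_elt a b k = walk t (elem_SL a b (red 'X^k%R)).
Proof.
move=> ab k3; apply: (walk_indep phiZ); apply: K_elem => //.
exact/cyc_lt_self/cyc_lt_neq/ab.
Qed.

Let root_elt_exp a b k : a != b -> k <= 3 -> root_elt a b k ^+ p = 1.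
Proof.
move=> ab k3; rewrite /root_elt -(walkX phiZ); last first.
  by apply: K_elem => //; apply: cyc_lt_self.
rewrite (elem_SLX _ _ ab); have -> : (red 'X^k *+ p = 0)%R.
  have -> : (red 'X^k *+ p = red ('X^k *+ p))%R by rewrite rmorphMn.
  by rewrite -mulr_natr -polyC_natr pchar_Fp_0 // mulr0 rmorph0.
by rewrite (elem_SL0 _ ab) (walk1 phiZ).
Qed.

Let root_elt_commute t a b c d i j : cyc_lt t a b -> cyc_lt t c d ->
  b != c -> a != d -> i <= 3 -> j <= 3 ->
  commute (root_elt a b i) (root_elt c d j).
Proof.
move=> ab cd bc ad i3 j3; rewrite (root_eltE ab i3) (root_eltE cd j3).
apply: (walk_commute phiZ ord0 (K_elem ab i3) (K_elem cd j3)).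
exact: elem_SL_commute (cyc_lt_neq ab) (cyc_lt_neq cd) bc ad.
Qed.

Let root_elt_cm t a b c i j : cyc_lt t a b -> cyc_lt t b c -> i + j <= 3 ->
  cm (root_elt a b i) (root_elt b c j) = root_elt a c (i + j).
Proof.
move=> ab bc ij; have ac : cyc_lt t a c by apply: ltn_trans bc.
have i3 : i <= 3 by lia.
have j3 : j <= 3 by lia.
rewrite (root_eltE ab i3) (root_eltE bc j3) (root_eltE ac ij).
apply: etrans (esym (walk_cm phiZ ord0 (K_elem ab i3) (K_elem bc j3))) _.
rewrite (elem_SL_cm _ _ (cyc_lt_neq ab) (cyc_lt_neq bc) (cyc_lt_neq ac)).
by congr (walk t (elem_SL _ _ _)); rewrite exprD [RHS]rmorphM.
Qed.

Let W := word (fun h : H => exists a b k,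
  [/\ a != b, k <= 3 & h = root_elt a b k]).

Let WV g : W g -> W g^-1.
Proof.
elim=> [|_ h [a [b [k [ab k3 ->]]]] _ IH]; first by rewrite invg1; apply: word1.
rewrite invgM; apply: wordMM IH _.
have -> : (root_elt a b k)^-1 = root_elt a b k ^+ p.-1.
  apply: mulg1_eq; rewrite -expgS prednK ?prime_gt0 //; exact: root_elt_exp.
elim: p.-1 => [|e IHe]; first exact: word1.
by rewrite expgS; apply: wordM IHe; exists a, b, k.
Qed.

(* Additivity in the entry reduces a polynomial of degree at most 3 to
   monomials. *)
Let W_elem t a b (r : {poly 'F_p}) : cyc_lt t a b -> size r <= 4 ->
  W (walk t (elem_SL a b (red r))).
Proof.
move=> ab r4; have anb := cyc_lt_neq ab.
pose Q (f : {poly 'F_p}) := size f <= 4 /\ W (walk t (elem_SL a b (red f))).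
have Q0 : Q 0%R.
  split; first by rewrite size_poly0.
  by rewrite rmorph0 (elem_SL0 _ anb) (walk1 phiZ); apply: word1.
have QX k : k <= 3 -> Q 'X^k%R.
  move=> k3; split; first exact: size_Xk.
  by rewrite -(root_eltE ab k3); apply: word_gen; exists a, b, k.
have QD f g : Q f -> Q g -> Q (f + g)%R.
  move=> [f4 Wf] [g4 Wg]; split.
    by apply: leq_trans (size_polyD _ _) _; rewrite geq_max f4.
  have -> : red (f + g)%R = (red f + red g)%R by rewrite rmorphD.
  rewrite (elem_SLD _ _ anb).
  exact: (eq_ind_r W (wordMM Wf Wg) (walkM phiZ ord0 _ (K_mod_elem s ab f4))).
suff : Q r by case.
clearbody Q; rewrite -[r]coefK poly_def; apply: (big_ind Q Q0 QD) => k _.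
rewrite -[(r`_k)%R]natr_Zp scaler_nat; move: (nat_of_ord (r`_k)%R) => e.
elim: e => [|e IHe]; first by rewrite mulr0n; exact: Q0.
rewrite mulrS; apply: QD IHe; apply: QX.
by have := ltn_ord k; lia.
Qed.

Let W_walk t (A : B) : subgroup_set (K t) A -> W (walk t A).
Proof.
case=> C KC <-; suff [] : subgroup_set (K t) (SL_map red C) /\
  W (walk t (SL_map red C)) by [].
have mapM (D E : SL {poly 'F_p} n.+1) :
    SL_map red (D * E) = SL_map red D * SL_map red E by apply: gmulfM.
have mapV (D : SL {poly 'F_p} n.+1) :
    SL_map red D^-1 = (SL_map red D)^-1 by apply: gmulfV.
have map1 : SL_map red (1 : SL {poly 'F_p} n.+1) = 1 by apply: gmulf1.
elim/K_poly_ind: KC => [|D E [KD WD] [KE WE]|D [KD WD]|a b r ab r4].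
- by rewrite map1; split; [exact: subgroup1|rewrite (walk1 phiZ); apply: word1].
- rewrite mapM; split; first exact: subgroupM.
  by rewrite (walkM phiZ _ _ KD); apply: wordMM.
- rewrite mapV; split; first exact: subgroupV.
  by rewrite (walkV phiZ _ KD); apply: WV.
- rewrite (SL_map_elem _ _ (cyc_lt_neq ab)).
  by split; [exact: K_mod_elem|exact: W_elem].
Qed.

Lemma cocycle_trivial : exists psi : vertex (X_complex n p s) -> L,
  forall e : @oedge (X_complex n p s),
    phi e = psi (val e).1 * (psi (val e).2)^-1.
Proof.
apply: (walk_cocycle_trivial phiZ (o := ord0) (W := W)).
- exact: word1.
- by move=> x y; apply: wordMM.
- exact: WV.
- exact: W_walk.
move=> x Wx x1.
have T : forall g : H, (hol_base g : B) = 1 -> g ^+ p = 1 -> g = 1.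
  exact: holonomy_torsion.
pose pi : UMagmaMorphism.type H B := @hol_base B L.
have := @cyclic_presentation_injective p s n.+1 3 H p_prime p_odd s_gt0 n_ge3
  (isT : 0 < 3) pi T.
move=> /(_ root_elt root_elt_exp).
move=> /(_ root_elt_commute).
move=> /(_ root_elt_cm).
apply=> //.
Qed.

End Main.

Theorem theorem6p2 (n s p : nat)
    (n_ge3 : (3 <= n)%N) (s_gt : (3 * n < s)%N)
    (p_prime : prime p) (p_odd : odd p)
    (L : groupType)
    (no_p_elt : ~ exists x : L, x <> 1%g /\ has_order x p) :
  H1_trivial (X_complex n p s) L.
Proof.
apply: H1_trivialP => phi phiZ.
have s_gt0 : (0 < s)%N by apply: leq_ltn_trans s_gt.
exact: (cocycle_trivial n_ge3 s_gt0 p_prime p_odd no_p_elt phiZ).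
Qed.
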